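(* Let $n,k$ be integers with $1\le k$ and $k+2\le n$, and let $Z$ be a real $n\times(k+2)$ matrix all of whose $(k+2)\times(k+2)$ minors are positive. Let $A_{n,k,2}=\varphi_2(\mathrm{Gr}(k,n)_{\ge 0})\subset \mathrm{Gr}(2,n)$ be the amplituhedron in twistor space, and for a rank $2$ positroid $\mathcal N$ on $[n]$ let $A_{\mathcal N}:=A_{n,k,2}\cap \mathring{\Pi}_{\mathcal N}$ (real points, not necessarily positive). Then for $\mathcal N\in Q_{n,2}$ we have $A_{\mathcal N}\neq\emptyset$ if and only if $\mathcal N\in P_{n,k}$ (so the nonempty open faces of $A_{n,k,2}$ are exactly the $A_{\mathcal N}$, $\mathcal N\in P_{n,k}$), and for every $\mathcal N\in P_{n,k}$, $$\overline{A_{\mathcal N}}=\bigcup_{\mathcal N'\in P_{n,k},\ \mathcal N'\le \mathcal N} A_{\mathcal N'},$$ where $\le$ is inclusion of positroids and the closure is taken in $\mathrm{Gr}(2,n)$.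
   Context: Notation: $[n]=\{1,\dots,n\}$; $\mathrm{Gr}(k,n)_{\ge0}$ is the set of $k$-planes in $\mathbb R^n$ all of whose Plücker coordinates $\Delta_K$ ($K\in\binom{[n]}{k}$) are nonnegative. For disjoint $K\in\binom{[n]}{k}$, $I\in\binom{[n]}{2}$, $\Delta_{KI}(Z)$ is the determinant of the $(k+2)\times(k+2)$ submatrix of $Z$ whose rows are those indexed by $K$ (in increasing order) followed by those indexed by $I$ (in increasing order); $\Delta_{KI}(Z)=0$ if $K\cap I\ne\emptyset$. The twistor map $\varphi_2:\mathrm{Gr}(k,n)\dashrightarrow \mathrm{Gr}(2,n)$ sends $C$ to the point with Plücker coordinates $\Delta_I(\varphi_2(C))=\langle I\rangle:=\sum_{K}\Delta_K(C)\Delta_{KI}(Z)$ (it is defined on all of $\mathrm{Gr}(k,n)_{\ge0}$ for such $Z$). Matroids are given by their set of bases. For $a\in[n]$, $\le_a$ is the total order $a<_a a+1<_a\cdots<_a n<_a 1<_a\cdots<_a a-1$. The Grassmann necklace $(I_1,\dots,I_n)$ of a matroid $\mathcal M$ has $I_a$ the lexicographically minimal basis of $\mathcal M$ with respect to $\le_a$. A positroid is the matroid of a point of a totally nonnegative Grassmannian; $Q_{n,k}$ is the poset of rank $k$ positroids on $[n]$ ordered by inclusion; the positroid envelope $\mathrm{env}(\mathcal M)$ is the smallest positroid containing $\mathcal M$ (equivalently the unique positroid with the same Grassmann necklace). For a positroid $\mathcal N$ of rank $r$ with Grassmann necklace $(I_1,\dots,I_n)$, the positroid variety $\Pi_{\mathcal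 N}\subset\mathrm{Gr}(r,n)$ is the set of points with $\Delta_J=0$ for all $J\notin\mathcal N$, and the open positroid variety $\mathring\Pi_{\mathcal N}$ is the subset of $\Pi_{\mathcal N}$ where $\Delta_{I_a}\neq 0$ for all $a$. For a matroid $\mathcal M$ of rank $k$ on $[n]$, $\mathcal M^*=\{[n]\setminus J: J\in\mathcal M\}$ and $\mathcal M^{\downarrow 2}=\{I\in\binom{[n]}{2}: I\subset J\text{ for some }J\in\mathcal M^*\}$. $P_{n,k}\subset Q_{n,2}$ is the set of positroids $\mathrm{env}(\mathcal M^{\downarrow2})$ for $\mathcal M\in Q_{n,k}$, ordered by inclusion. *)

(* Defs.v *)
From HB Require Import structures.
From mathcomp Require Import all_boot all_order all_algebra.
From mathcomp Require Import all_classical reals topology normedtype.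

Set Implicit Arguments.
Unset Strict Implicit.
Unset Printing Implicit Defensive.

Import Order.TTheory GRing.Theory Num.Theory.
Import numFieldTopology.Exports.

Local Open Scope classical_set_scope.
Local Open Scope ring_scope.

Definition Gr (R : realType) (r n : nat) : Type :=
  {V : {vspace 'rV[R]_n} | \dim V == r}.

HB.instance Definition _ (R : realType) (r n : nat) := Choice.on (Gr R r n).

Section GrTopology.
Context {R : realType} {r n : nat}.

Definition frame (M : 'M[R]_(r, n)) (V : Gr R r n) : bool :=
  basis_of (val V) [seq row i M | i <- enum 'I_r].

(* Gr(r, n) carries the quotient topology from the r x n matrices of rank r,
   themselves a subspace of all r x n matrices: O is an ambient open set that
   cuts out the preimage of U among the matrices of rank r. *)
Definition Gr_open (U : set (Gr R r n)) : Prop :=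
  exists2 O : set 'M[R]_(r, n), open O &
    forall M V, frame M V -> (O M <-> U V).

Lemma Gr_openT : Gr_open setT.
Proof. by exists setT; [exact: openT|]. Qed.

Lemma Gr_openI : setI_closed Gr_open.
Proof.
move=> A B [O oO OA] [O' oO' OB]; exists (O `&` O'); first exact: openI.
by move=> M V MV; split=> -[/(OA _ _ MV) ? /(OB _ _ MV) ?].
Qed.

Lemma Gr_open_bigU (I : Type) (f : I -> set (Gr R r n)) :
  (forall i, Gr_open (f i)) -> Gr_open (\bigcup_i f i).
Proof.
move=> fo; pose O i := sval (cid2 (fo i)).
exists (\bigcup_i O i).
  by apply: bigcup_open => i _; rewrite /O; case: cid2.
move=> M V MV; split=> -[i _ h]; exists i => //; move: h; rewrite /O;
  by case: cid2 => /= ? _ /(_ _ _ MV) [].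
Qed.

HB.instance Definition _ := isOpenTopological.Build (Gr R r n)
  Gr_openT Gr_openI Gr_open_bigU.

End GrTopology.

(* Determinant of the rows of A listed in s, in that order; only meaningful
   when size s = m. *)
Definition row_minor (R : realType) (n m : nat) (A : 'M[R]_(n, m))
    (s : seq 'I_n) : R :=
  \det (\matrix_(i < m, j < m) [seq A a j | a <- s]`_i).

(* Plücker coordinates computed in the basis chosen by vbasis. Another basis
   multiplies all of them by a common nonzero scalar, so only properties
   insensitive to such a scalar are used below. *)
Definition plucker (R : realType) (r n : nat) (V : Gr R r n)
    (K : {set 'I_n}) : R :=
  row_minor (\matrix_(i < r) (vbasis (val V))`_i)^T (enum K).

Definition Gr_tnn (R : realType) (r n : nat) : set (Gr R r n) :=
  [set V | exists2 c : R, c != 0 &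
    forall K : {set 'I_n}, #|K| = r -> 0 <= c * plucker V K].

Definition matroid_of (R : realType) (r n : nat) (V : Gr R r n) :
    {set {set 'I_n}} :=
  [set K : {set 'I_n} | (#|K| == r) && (plucker V K != 0)]%SET.

(* The set of bases, ordered by \subset, stands for the matroid. *)
Definition positroids (R : realType) (n r : nat) : set {set {set 'I_n}} :=
  [set N | exists2 V : Gr R r n, Gr_tnn V & N = matroid_of V].

(* Position of i in the order a < a + 1 < ... < a - 1. *)
Definition cyc_pos (n : nat) (a i : 'I_n) : nat := (i + (n - a)) %% n.

Definition cyc_word (n : nat) (a : 'I_n) (J : {set 'I_n}) : seqlexi nat :=
  sort leq [seq cyc_pos a i | i <- enum J].

(* The [pick] always succeeds when N is nonempty, and then uniquely. *)
Definition necklace (n : nat) (N : {set {set 'I_n}}) (a : 'I_n) : {set 'I_n} :=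
  odflt finset.set0
    [pick I in N | [forall J in N, (cyc_word a I <= cyc_word a J)%O]].

Definition positroid_variety (R : realType) (r n : nat)
    (N : {set {set 'I_n}}) : set (Gr R r n) :=
  [set V | forall J : {set 'I_n}, #|J| = r -> J \notin N -> plucker V J = 0].

Definition open_positroid_variety (R : realType) (r n : nat)
    (N : {set {set 'I_n}}) : set (Gr R r n) :=
  [set V | @positroid_variety R r n N V /\
           forall a : 'I_n, plucker V (necklace N a) != 0].

Definition is_envelope (R : realType) (n r : nat) (M N : {set {set 'I_n}}) :
    Prop :=
  [/\ positroids R r N, M \subset N &
      forall N', positroids R r N' -> M \subset N' -> N \subset N'].

Definition dual_matroid (n : nat) (M : {set {set 'I_n}}) : {set {set 'I_n}} :=
  [set finset.setC J | J in M]%SET.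

Definition down2 (n : nat) (M : {set {set 'I_n}}) : {set {set 'I_n}} :=
  [set I : {set 'I_n} |
    (#|I| == 2) && [exists J in dual_matroid M, I \subset J]]%SET.

(* P_{n,k} *)
Definition env_down2_positroids (R : realType) (n k : nat) :
    set {set {set 'I_n}} :=
  [set N | exists2 M, positroids R k M & is_envelope R 2 (down2 M) N].

Definition minor_KI (R : realType) (n k : nat) (Z : 'M[R]_(n, k.+2))
    (K I : {set 'I_n}) : R :=
  if [disjoint K & I] then row_minor Z (enum K ++ enum I) else 0.

Definition twistor_coord (R : realType) (n k : nat) (Z : 'M[R]_(n, k.+2))
    (C : Gr R k n) (I : {set 'I_n}) : R :=
  \sum_(K : {set 'I_n} | #|K| == k) plucker C K * minor_KI Z K I.

(* Graph of the partial map varphi_2: W is the image of C when the two vectors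
   of Plücker coordinates agree as points of projective space. *)
Definition twistor (R : realType) (n k : nat) (Z : 'M[R]_(n, k.+2))
    (C : Gr R k n) (W : Gr R 2 n) : Prop :=
  exists2 c : R, c != 0 &
    forall I : {set 'I_n}, #|I| = 2 -> plucker W I = c * twistor_coord Z C I.

Definition amplituhedron (R : realType) (n k : nat) (Z : 'M[R]_(n, k.+2)) :
    set (Gr R 2 n) :=
  [set W | exists2 C : Gr R k n, Gr_tnn C & twistor Z C W].

Definition amplituhedron_face (R : realType) (n k : nat)
    (Z : 'M[R]_(n, k.+2)) (N : {set {set 'I_n}}) : set (Gr R 2 n) :=
  amplituhedron Z `&` @open_positroid_variety R 2 n N.

(* Main.v *)
(* Write W = phi_2(C). By Cauchy-Binet the coordinates of W are signed sums of
   the Plücker coordinates of C, with the sign of the K-term of <i j> given by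
   the parity of the number of elements of K between i and j. If {i, b} is
   the first basis of N met when turning from i, then <i l> = 0 on the open
   arc (i, b), and an induction along the arc shows that every basis K of C
   avoiding i contains that arc. All terms of <i b> then have the same sign, so
   <i b> = 0 only if no basis avoids both i and b. Since the Grassmann
   necklace of a rank 2 positroid consists of such first bases, N is the
   envelope of down2 of the matroid of C whenever W lies in the open variety of N.

   The amplituhedron is closed by compactness of Gr(k, n)_{>= 0}. Conversely, if
   down2 of the matroid of C is contained in N, the dual D of C has zero columns
   on the loops of N and parallel columns on its parallel classes. Multiplying
   the matrix of class vectors by the totally positive kernel q^((i-j)^2), with
   q small, and making all ratios within a class nonzero, gives points D_q -> D
   whose bases are exactly the transversals of N. Their duals have down2 equal
   to N and are mapped into A_N, to points tending to W. *)
Require Import Defs.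
From HB Require Import structures.
From mathcomp Require Import all_boot all_order all_algebra all_fingroup.
From mathcomp Require Import all_classical reals topology normedtype.
From mathcomp Require Import ring lra zify.

Set Implicit Arguments.
Unset Strict Implicit.
Unset Printing Implicit Defensive.

Import Order.TTheory GRing.Theory Num.Theory.
Import numFieldTopology.Exports.

Local Open Scope ring_scope.

(** * Minors *)

(** A single vanishing coordinate <i j> says nothing about the bases, because its terms may cancel;
    vanishing along a whole arc starting at [i] does. What makes this enough is a noncrossing
    property of a rank 2 positroid [N]: if {i, j} is not in [N], then on one of the arcs (i, j] and
    (j, i] no element forms a basis with the starting point of the arc. The same property shows that
    a positroid containing the first bases of a family of pairs contains the whole family, which is
    how all inclusions between envelopes are obtained. A point of Gr(2, n) that is not nonnegative
    must also be assigned its positroid. It is read off from the runs of consecutive parallel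
    columns, the last run being joined to the first one when they are parallel; the same structure,
    [block_data], later carries the deformation. The class that wraps around is the obstacle in both
    places: its tail spoils the order of the columns, and a sign (-1)^(r-1) on the tail, in rank r,
    repairs this. *)

Section RowMinor.
Variables (R : realType) (n m : nat).
Implicit Types (A : 'M[R]_(n, m)) (s : seq 'I_n) (K : {set 'I_n}).

Lemma row_minorE A (x0 : 'I_n) s : size s = m ->
  row_minor A s = \det (rowsub (fun i : 'I_m => nth x0 s i) A).
Proof.
move=> sz; congr (\det _); apply/matrixP => i j; rewrite !mxE.
by rewrite (nth_map x0) // sz.
Qed.

Lemma row_minor_perm s s' : size s = m -> perm_eq s s' ->
  exists b : bool, forall A : 'M[R]_(n, m), row_minor A s' = (-1) ^+ b * row_minor A s.
Proof.
move=> sz pss'; have [x0|s0] : 'I_n + (s = [::]) by case: (s) => [|x s1]; [right|left].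
  2: by move: pss'; rewrite s0 perm_sym => /perm_nilP ->; exists false => B; rewrite mul1r.
have sz' : size s' == m by rewrite -(perm_size pss') sz.
have /tuple_permP [p def_s] : perm_eq s (Tuple sz') by [].
exists (p^-1)%g => B.
rewrite (row_minorE _ x0) ?(eqP sz') // (row_minorE _ x0) //.
have -> : rowsub (fun i : 'I_m => nth x0 s' i) B =
    row_perm (p^-1)%g (rowsub (fun i : 'I_m => nth x0 s i) B).
  apply/matrixP => i j; rewrite !mxE def_s; congr (B _ j).
  rewrite (nth_map i) ?size_enum_ord // nth_ord_enum permKV.
  by rewrite (tnth_nth x0).
by rewrite row_permE det_mulmx det_perm.
Qed.

Lemma row_minor_swap A s1 s2 x y : size (s1 ++ x :: y :: s2) = m ->
  row_minor A (s1 ++ x :: y :: s2) = - row_minor A (s1 ++ y :: x :: s2).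
Proof.
move=> sz; have szl : (size s1 < m)%N by rewrite -sz size_cat /=; lia.
have szl' : ((size s1).+1 < m)%N by rewrite -sz size_cat /=; lia.
pose a := Ordinal szl; pose b := Ordinal szl'.
rewrite (row_minorE _ x) // (row_minorE _ x); last first.
  by move: sz; rewrite !size_cat.
have -> : rowsub (fun i : 'I_m => nth x (s1 ++ x :: y :: s2) i) A =
    row_perm (tperm a b) (rowsub (fun i : 'I_m => nth x (s1 ++ y :: x :: s2) i) A).
  apply/matrixP => i j; rewrite !mxE; congr (A _ j).
  have [->|nia] := eqVneq i a.
    by rewrite tpermL /= !nth_cat !ltnn ltnNge leqnSn /= subnn subSn // subnn.
  have [->|nib] := eqVneq i b.
    by rewrite tpermR /= !nth_cat !ltnn ltnNge leqnSn /= subnn subSn // subnn.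
  rewrite tpermD // 1?eq_sym // !nth_cat; case: ltnP => // le1.
  have -> : (i - size s1 = (i - size s1).-2.+2)%N.
    by move: nia nib le1; rewrite -!val_eqE /=; lia.
  by [].
rewrite row_permE det_mulmx det_perm odd_tperm.
suff -> : a != b by rewrite mulN1r.
by rewrite -val_eqE /= neq_ltn leqnn.
Qed.

Lemma row_minor_move A s1 s2 s3 x : size (s1 ++ x :: s2 ++ s3) = m ->
  row_minor A (s1 ++ x :: s2 ++ s3) =
  (-1) ^+ size s2 * row_minor A (s1 ++ s2 ++ x :: s3).
Proof.
elim: s2 s1 => [|y s2 IH] s1 sz /=; first by rewrite mul1r.
rewrite row_minor_swap // -cat_rcons IH; last first.
  by move: sz; rewrite !size_cat size_rcons /= size_cat; lia.
by rewrite cat_rcons exprS -mulrA mulN1r.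
Qed.

Lemma row_minor_notuniq A s : size s = m -> ~~ uniq s -> row_minor A s = 0.
Proof.
move=> sz; have [x0|e] : 'I_n + (s = [::]).
- by case: s sz => [|x s] _; [right|left].
- rewrite (row_minorE _ x0) //.
  move=> /(uniqPn x0) [i [j [ltij]]]; rewrite sz => ltj eqn.
  have lti := ltn_trans ltij ltj.
  apply: (@determinant_alternate _ _ _ (Ordinal lti) (Ordinal ltj)).
    by rewrite -val_eqE /= ltn_eqF.
  by move=> l; rewrite !mxE /= eqn.
- by rewrite e.
Qed.

Lemma enum_set_sorted K : sorted ltn [seq val i | i <- enum K].
Proof.
apply: (subseq_sorted ltn_trans _ (iota_ltn_sorted 0 n)).
by rewrite -val_enum_ord map_subseq // [in X in subseq _ X]enumT /enum_mem filter_subseq.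
Qed.

Lemma enum_set_eq s K : sorted ltn [seq val i | i <- s] -> s =i K -> s = enum K.
Proof.
move=> ss sK; apply: (inj_map val_inj).
apply: (irr_sorted_eq ltn_trans ltnn ss (enum_set_sorted K)) => i.
by apply/mapP/mapP => -[j jK ->]; exists j => //; move: jK; rewrite mem_enum sK.
Qed.

Lemma enum_split K x : enum K =
  enum [set y in K | (y < x)%N] ++ enum [set y in K | (x <= y)%N].
Proof.
symmetry; apply: enum_set_eq.
  rewrite map_cat (sorted_pairwise ltn_trans) pairwise_cat.
  rewrite -!(sorted_pairwise ltn_trans) !enum_set_sorted !andbT.
  apply/allrelP => _ _ /mapP[i + ->] /mapP[j + ->].
  by rewrite !mem_enum !inE => /andP[_ ix] /andP[_ xj]; apply: leq_trans xj.
move=> y; rewrite mem_cat !mem_enum !inE -andb_orr.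
by case: ltnP; rewrite andbT.
Qed.

(** Sorting [x] into [enum K] takes one transposition for each smaller element of [K]. The signs of
    the twistor coordinates and of duality are counted this way. *)
Lemma row_minor_insert A s1 K s2 x : size (s1 ++ x :: enum K ++ s2) = m ->
  x \notin K ->
  row_minor A (s1 ++ x :: enum K ++ s2) =
  (-1) ^+ #|[set y in K | (y < x)%N]| * row_minor A (s1 ++ enum (x |: K) ++ s2).
Proof.
move=> sz xK.
have -> : enum (x |: K) = enum [set y in K | (y < x)%N] ++ x ::
    enum [set y in K | (x <= y)%N].
  rewrite (enum_split _ x); congr (_ ++ _).
    apply: eq_enum => y; rewrite !inE; have [->|] := eqVneq y x; rewrite ?ltnn ?andbF //=.
  symmetry; apply: enum_set_eq.
    rewrite map_cons /= path_min_sorted ?enum_set_sorted //.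
    apply/allP => _ /mapP[i + ->]; rewrite mem_enum inE => /andP[iK].
    by rewrite leq_eqVlt => /orP[/eqP/val_inj xi|//]; rewrite xi iK in xK.
  move=> y; rewrite in_cons mem_enum !inE; have [->|] := eqVneq y x;
    rewrite ?ltnn ?leqnn ?andbF ?orbT //=.
have := sz; rewrite {1 2}(enum_split K x) -!catA => sz'.
by rewrite row_minor_move // -cardE.
Qed.

Lemma row_minor_absE A s : size s = m ->
  `|row_minor A s| = (uniq s)%:R * `|row_minor A (enum [set x in s])|.
Proof.
move=> sz; case: (boolP (uniq s)) => us; last first.
  by rewrite row_minor_notuniq // normr0 mul0r.
have ps : perm_eq s (enum [set x in s]).
  rewrite uniq_perm ?enum_uniq // => x; by rewrite mem_enum inE.
have [b ->] := row_minor_perm sz ps.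
by rewrite normrM normrX normrN1 expr1n !mul1r.
Qed.

End RowMinor.

(** * Cauchy-Binet with extra rows, minors of a kernel, Cramer's rule *)

Section CauchyBinet.
Variable R : realType.

Lemma det_col_mx_mul_ffun n k m (C : 'M[R]_(k, n)) (Z : 'M[R]_(n, k + m))
    (T : 'M[R]_(m, k + m)) :
  \det (col_mx (C *m Z) T) =
  \sum_(f : {ffun 'I_k -> 'I_n})
    (\prod_i C i (f i)) * \det (col_mx (rowsub f Z) T).
Proof.
under eq_bigr do rewrite mulr_sumr; rewrite exchange_big /=.
apply: eq_bigr => s _; rewrite big_split_ord /=.
under eq_bigr do rewrite col_mxEu mxE.
rewrite bigA_distr_bigA /= mulrC -mulrA mulr_suml; apply: eq_bigr => f _.
rewrite big_split_ord /= [in LHS]big_split /=.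
under [X in _ = _ * (_ * (X * _))]eq_bigr do rewrite col_mxEu mxE.
under [X in _ * (X * _) = _]eq_bigr do rewrite col_mxEd.
under [X in _ = _ * (_ * (_ * X))]eq_bigr do rewrite col_mxEd.
by rewrite -!mulrA; congr (_ * _); rewrite mulrA [RHS]mulrC.
Qed.

(** The rows of [T], later the rows of [Z] indexed by a pair, ride along unchanged. Maps that are
    not injective repeat a row and drop out; the others are grouped by their image [K]. *)
Lemma det_col_mx_mul n k m (C : 'M[R]_(k, n)) (Z : 'M[R]_(n, k + m))
    (T : 'M[R]_(m, k + m)) (x0 : 'I_n) :
  \det (col_mx (C *m Z) T) =
  \sum_(K : {set 'I_n} | #|K| == k) row_minor C^T (enum K) *
    \det (col_mx (rowsub (fun i : 'I_k => nth x0 (enum K) i) Z) T).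
Proof.
have notinj (f : {ffun 'I_k -> 'I_n}) : #|f @: [set: 'I_k]%SET| != k ->
    \det (col_mx (rowsub f Z) T) = 0.
  move=> fk; have /injectivePn [i [j nij fij]] : ~~ injectiveb f.
    apply: contra fk => /injectiveP fi.
    by rewrite card_imset // cardsT card_ord.
  apply: (@determinant_alternate _ _ _ (lshift m i) (lshift m j)) => [|l].
    by rewrite (inj_eq (@lshift_inj _ _)).
  by rewrite !col_mxEu !mxE fij.
rewrite det_col_mx_mul_ffun (partition_big (fun f : {ffun _} => f @: [set: 'I_k]%SET) predT) //=.
rewrite (bigID (fun K : {set 'I_n} => #|K| == k)) /= [X in _ + X]big1 ?addr0; last first.
  by move=> K Kk; apply: big1 => f /eqP fK; rewrite notinj ?mulr0 // fK.
apply: eq_bigr => K /eqP Kk.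
pose e (i : 'I_k) := nth x0 (enum K) i.
have szK : size (enum K) = k by rewrite -cardE.
have e_inj : injective e.
  move=> i j /eqP; rewrite /e nth_uniq ?szK ?enum_uniq // => /eqP.
  exact: val_inj.
have eK i : e i \in K by rewrite -mem_enum mem_nth // szK.
transitivity (\sum_(f : {ffun 'I_k -> 'I_n} | [forall i, f i \in K])
    (\prod_i C i (f i)) * \det (col_mx (rowsub f Z) T)).
  rewrite [RHS](bigID (fun f : {ffun _} => f @: [set: 'I_k]%SET == K)) /=.
  rewrite [X in _ = _ + X]big1 ?addr0.
    apply: eq_bigl => f; apply/idP/idP => [/eqP fK|/andP[]//].
    rewrite fK eqxx andbT; apply/forallP => i.
    by rewrite -fK imset_f // inE.
  move=> f /andP[/forallP fK nfK]; rewrite notinj ?mulr0 //.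
  apply: contra nfK => /eqP fk; rewrite eqEcard fk Kk leqnn andbT.
  by apply/fintype.subsetP => _ /imsetP[i _ ->].
rewrite (reindex_onto (fun g : {ffun 'I_k -> 'I_k} => [ffun i => e (g i)])
  (fun f : {ffun 'I_k -> 'I_n} => [ffun i => odflt i [pick j | e j == f i]])) /=; last first.
  move=> f /forallP fK; apply/ffunP => i; rewrite !ffunE.
  case: pickP => [j /eqP//|no].
  have := fK i; rewrite -mem_enum => /(nthP x0) [j]; rewrite szK => ltj ej.
  by have := no (Ordinal ltj); rewrite /e /= ej eqxx.
have -> : row_minor C^T (enum K) = \det (colsub e C).
  rewrite (row_minorE _ x0) // -det_tr; congr (\det _).
  by apply/matrixP => i j; rewrite !mxE.
(* For fixed [K] the sum is the same multilinear expansion, read backwards for the square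
   submatrices on [K]. *)
transitivity (\det (col_mx (colsub e C *m rowsub e Z) T)).
  rewrite det_col_mx_mul_ffun; apply: eq_big => [g|g _].
    apply/andP; split; first by apply/forallP => i; rewrite ffunE.
    apply/eqP/ffunP => i; rewrite !ffunE.
    case: pickP => [j|/(_ (g i))]; rewrite ?ffunE ?eqxx // => /eqP.
    exact: e_inj.
  congr (_ * _); first by apply: eq_bigr => i _; rewrite ffunE mxE.
  congr (\det (col_mx _ _)); apply/matrixP => i j; rewrite !mxE.
  by congr (Z _ _); rewrite ffunE.
have -> : col_mx (colsub e C *m rowsub e Z) T =
    block_mx (colsub e C) 0 0 1%:M *m col_mx (rowsub e Z) T.
  by rewrite mul_block_col mul0mx addr0 mul0mx add0r mul1mx.
by rewrite det_mulmx det_lblock det1 mulr1.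
Qed.

Lemma row_minor_cat n k m (Z : 'M[R]_(n, k + m)) (s t : seq 'I_n) (x0 : 'I_n) :
  size s = k -> size t = m ->
  row_minor Z (s ++ t) = \det (col_mx (rowsub (fun i : 'I_k => nth x0 s i) Z)
                                      (rowsub (fun i : 'I_m => nth x0 t i) Z)).
Proof.
move=> sk tm; rewrite (row_minorE _ x0) ?size_cat ?sk ?tm //.
congr (\det _); apply/matrixP => i j; rewrite mxE -[i]splitK.
case: (fintype.split i) => l /=.
  by rewrite col_mxEu nth_cat sk ltn_ord mxE.
by rewrite col_mxEd nth_cat sk ltnNge leq_addr /= addKn mxE.
Qed.

(* Completing the kernel of [C *m Z] to a basis, the minors of [Z] restricted
   to this kernel are complementary to those of [C *m Z]. *)
Lemma kernel_minors n k m p (C : 'M[R]_(k, n)) (Z : 'M[R]_(n, p))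
    (x0 : 'I_n) (t0 : seq 'I_n) : p = (k + m)%N -> size t0 = m ->
  \sum_(K : {set 'I_n} | #|K| == k)
    row_minor C^T (enum K) * row_minor Z (enum K ++ t0) != 0 ->
  exists Y : 'M[R]_(p, m), exists2 c : R, c != 0 &
    forall t, size t = m -> row_minor (Z *m Y) t = c *
      \sum_(K : {set 'I_n} | #|K| == k)
         row_minor C^T (enum K) * row_minor Z (enum K ++ t).
Proof.
move=> ep; subst p => t0m.
pose sub t := rowsub (fun i : 'I_m => nth x0 t i) Z.
have sumE t : size t = m -> \sum_(K : {set 'I_n} | #|K| == k)
    row_minor C^T (enum K) * row_minor Z (enum K ++ t) =
    \det (col_mx (C *m Z) (sub t)).
  move=> tm; rewrite (det_col_mx_mul _ _ _ x0); apply: eq_bigr => K /eqP Kk.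
  by rewrite (row_minor_cat _ x0) // -cardE.
rewrite sumE // => nz; set A := C *m Z in nz sumE *.
have rA : \rank A = k.
  move: nz; rewrite -unitfE -unitmxE -row_free_unit => /eqP e.
  have := (mxrank_adds_leqif A (sub t0)).1.
  rewrite addsmxE e; have := rank_leq_row A; have := rank_leq_row (sub t0); lia.
(* [Q] column-reduces [A] to the block row (L, 0), so its last [m] columns span the kernel of [A]
   and the stacked matrix times [Q] becomes block triangular. *)
pose Q := invmx (row_ebase A).
have QU : Q \in unitmx by rewrite unitmx_inv row_ebase_unit.
pose L := col_ebase A.
have AQ : A *m Q = row_mx L 0.
  rewrite -[X in X *m _](mulmx_ebase A) mulmxK ?row_ebase_unit // rA -/L.
  apply/matrixP => i j; rewrite mxE -[j]splitK; case: (fintype.split j) => l /=.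
    rewrite row_mxEl (bigD1 l) //= !mxE eqxx ltn_ord mulr1 big1 ?addr0 // => l'.
    by rewrite !mxE -val_eqE /= => /negPf ->; rewrite mulr0.
  rewrite row_mxEr mxE big1 // => l' _; rewrite !mxE /= [_ == _]ltn_eqF ?mulr0 //.
  exact: ltn_addr.
have LU : \det L != 0 by rewrite -unitfE -unitmxE col_ebase_unit.
exists (rsubmx Q), (\det Q / \det L) => [|t tm].
  by rewrite mulf_neq0 ?invr_neq0 // -unitfE -unitmxE.
rewrite sumE // (row_minorE _ x0) //.
have : \det (col_mx A (sub t) *m Q) = \det L * \det (sub t *m rsubmx Q).
  rewrite mul_col_mx AQ -[in sub t *m Q](hsubmxK Q) mul_mx_row.
  by rewrite -[col_mx _ _]/(block_mx L 0 _ _) det_lblock.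
rewrite det_mulmx => e.
have -> : rowsub (fun i : 'I_m => nth x0 t i) (Z *m rsubmx Q) = sub t *m rsubmx Q.
  by rewrite mul_rowsub_mx.
by rewrite mulrAC [_ * \det (col_mx _ _)]mulrC e [\det L * _]mulrC mulfK.
Qed.

(** Cramer's rule for the column [x] in terms of the columns listed in [s], free of division since
    it comes from [\adj B *m B]. It serves to bound the entries of a normalized frame, to put a
    nonzero column into a basis, and to compare parallel columns. *)
Lemma row_minor_cramer n r (A : 'M[R]_(r, n)) (s : seq 'I_n) (x : 'I_n) (a : 'I_r) :
  size s = r ->
  row_minor A^T s * A a x =
  \sum_(i < r) row_minor A^T (set_nth x s i x) * A a (nth x s i).
Proof.
move=> sr; pose B := rowsub (fun i : 'I_r => nth x s i) A^T.
have E (i : 'I_r) : row_minor A^T (set_nth x s i x) =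
    \sum_l A l x * cofactor B i l.
  have szs : size (set_nth x s i x) = r.
    by rewrite size_set_nth sr; apply/maxn_idPr.
  rewrite (row_minorE _ x) // (expand_det_row _ i); apply: eq_bigr => l _.
  rewrite !mxE nth_set_nth /= eqxx; congr (_ * _).
  rewrite /cofactor; congr (_ * \det _); apply/matrixP => u v.
  by rewrite !mxE nth_set_nth /= ifN_eqC ?neq_bump.
under eq_bigr do rewrite E mulr_suml.
rewrite exchange_big /=.
transitivity (\sum_l A l x * (\adj B *m B) l a).
  rewrite mul_adj_mx (bigD1 a) //= !mxE eqxx mulr1n big1 ?addr0 => [|l la].
    by rewrite mulrC (row_minorE _ x).
  by rewrite !mxE (negPf la) mulr0n mulr0.
apply: eq_bigr => l _; rewrite mxE mulr_sumr; apply: eq_bigr => i _.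
by rewrite !mxE mulrA.
Qed.
End CauchyBinet.

(** * Frames and the topology of the Grassmannian *)

Section MatrixLimits.
Import numFieldNormedType.Exports.
Local Open Scope classical_set_scope.
Variables (R : realType) (T : Type) (F : set_system T).
Context {FF : Filter F}.

Lemma cvg_bigsum (I : Type) (s : seq I) (P : pred I) (f : I -> T -> R) (l : I -> R) :
  (forall i, f i x @[x --> F] --> l i) ->
  \sum_(i <- s | P i) f i x @[x --> F] --> \sum_(i <- s | P i) l i.
Proof.
move=> fl; elim: s => [|i s IH].
  by under eq_fun do rewrite big_nil; rewrite big_nil; exact: cvg_cst.
under eq_fun do rewrite big_cons; rewrite big_cons; case: ifP => // _.
exact: cvgD.
Qed.

Lemma cvg_bigsum_cond (I : finType) (P : pred I) (f : I -> T -> R) (l : I -> R) :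
  (forall i, P i -> f i x @[x --> F] --> l i) ->
  \sum_(i | P i) f i x @[x --> F] --> \sum_(i | P i) l i.
Proof.
move=> fl; rewrite big_mkcond; under eq_fun do rewrite big_mkcond.
by apply: cvg_bigsum => i; case: ifP => [/fl //|_]; exact: cvg_cst.
Qed.

Lemma cvg_bigprod (I : Type) (s : seq I) (P : pred I) (f : I -> T -> R) (l : I -> R) :
  (forall i, f i x @[x --> F] --> l i) ->
  \prod_(i <- s | P i) f i x @[x --> F] --> \prod_(i <- s | P i) l i.
Proof.
move=> fl; elim: s => [|i s IH].
  by under eq_fun do rewrite big_nil; rewrite big_nil; exact: cvg_cst.
under eq_fun do rewrite big_cons; rewrite big_cons; case: ifP => // _.
exact: cvgM.
Qed.

Lemma cvg_exprn (f : T -> R) (l : R) m :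
  f x @[x --> F] --> l -> f x ^+ m @[x --> F] --> l ^+ m.
Proof.
move=> fl; elim: m => [|m IH]; first exact: cvg_cst.
by under eq_fun do rewrite exprS; rewrite exprS; exact: cvgM.
Qed.

Lemma cvg_det m (f : T -> 'M[R]_m) (L : 'M[R]_m) :
  (forall i j, f x i j @[x --> F] --> L i j) ->
  \det (f x) @[x --> F] --> \det L.
Proof.
move=> fL; apply: cvg_bigsum => s; apply: cvgM; first exact: cvg_cst.
by apply: cvg_bigprod => i; exact: fL.
Qed.

Lemma cvg_row_minor n m (f : T -> 'M[R]_(n, m)) (L : 'M[R]_(n, m)) s :
  (forall i j, f x i j @[x --> F] --> L i j) ->
  row_minor (f x) s @[x --> F] --> row_minor L s.
Proof.
move=> fL; apply: cvg_det => i j; rewrite mxE.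
under eq_fun do rewrite mxE.
have [lti|gei] := ltnP i (size s).
  have x0 : 'I_n by case: (s) lti.
  by rewrite (nth_map x0) //; under eq_fun do rewrite (nth_map x0) //; exact: fL.
rewrite nth_default ?size_map //.
by under eq_fun do rewrite nth_default ?size_map //; exact: cvg_cst.
Qed.

Lemma cvg_mx m n (f : T -> 'M[R]_(m, n)) (L : 'M[R]_(m, n)) :
  (forall i j, f x i j @[x --> F] --> L i j) -> f x @[x --> F] --> L.
Proof.
move=> fL A [P nP sPA]; apply: (@filterS _ F _
  (fun x => forall ij : 'I_m * 'I_n, P ij.1 ij.2 (f x ij.1 ij.2))).
  by move=> x h; apply: sPA => i j; exact: (h (i, j)).
by apply: filter_forall => -[i j]; exact: (fL i j _ (nP i j)).
Qed.

End MatrixLimits.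

(** Plücker coordinates of a given frame. [plucker] relies on the basis picked by [vbasis], about
    whose continuity nothing is known, so limits are taken with this version. *)
Definition max_minor (R : realType) (r n : nat) (M : 'M[R]_(r, n))
  (K : {set 'I_n}) : R := row_minor M^T (enum K).

Section Frames.
Variables (R : realType) (r n : nat).
Implicit Types (M : 'M[R]_(r, n)) (V : Gr R r n) (K : {set 'I_n}).

Lemma max_minor_mull (g : 'M[R]_r) M K : #|K| = r ->
  max_minor (g *m M) K = \det g * max_minor M K.
Proof.
move=> Kr; have sK : size (enum K) = r by rewrite -cardE.
have [x0|e] : 'I_n + (K = finset.set0).
- by case: (pickP (mem K)) => [x _|K0]; [left|right; apply/setP => x; rewrite inE; apply: K0].
- rewrite /max_minor !(row_minorE _ x0) // -[in RHS](det_tr g) mulrC -det_mulmx.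
  by congr (\det _); rewrite trmx_mul mul_rowsub_mx.
- have r0 : r = 0%N by rewrite -Kr e cards0.
  move: g M; rewrite /max_minor /row_minor; subst r; rewrite r0 => g M.
  by rewrite !det_mx00 mulr1.
Qed.

Definition row_seq M : r.-tuple _ := [tuple row i M | i < r].

Lemma nth_row_seq M (i : 'I_r) : (row_seq M)`_i = row i M.
Proof. by rewrite (nth_map i) ?size_enum_ord // nth_ord_enum. Qed.

Lemma free_row_seq M : free (row_seq M) = row_free M.
Proof.
have comb (u : 'rV_r) : \sum_(i < r) u 0 i *: (row_seq M)`_i = u *m M.
  by rewrite mulmx_sum_row; apply: eq_bigr => i _; rewrite nth_row_seq.
apply/freeP/row_freeP => [fM|[B MB] k].
  apply/row_freeP/inj_row_free => u; rewrite -comb => e; have u0 := fM (fun i => u 0 i) e.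
  by apply/rowP => i; rewrite u0 mxE.
pose u : 'rV_r := \row_i k i => /= k0 i.
have : u *m M = 0.
  by rewrite -comb -[RHS]k0; apply: eq_bigr => j _; rewrite mxE.
move=> /(congr1 (mulmx^~ B)); rewrite -mulmxA MB mulmx1 mul0mx.
by move=> /rowP/(_ i); rewrite !mxE.
Qed.

Lemma frame_row_free M V : frame M V -> row_free M.
Proof. by rewrite -free_row_seq => /andP[]. Qed.

Lemma frame_vbasis V : frame (\matrix_(i < r) (vbasis (val V))`_i) V.
Proof.
have sz : size (vbasis (val V)) = r by rewrite size_tuple (eqP (valP V)).
rewrite /frame; set s := map _ _.
suff -> : s = vbasis (val V) by exact: vbasisP.
apply: (@eq_from_nth _ 0); first by rewrite size_map size_enum_ord sz.
move=> i; rewrite size_map size_enum_ord => ir.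
by rewrite (nth_row_seq _ (Ordinal ir)) rowK.
Qed.

Lemma row_free_frame M : row_free M -> exists V, frame M V.
Proof.
rewrite -free_row_seq => fM.
have dM : \dim <<row_seq M>> == r by rewrite (eqP (fM : free _)) size_tuple.
exists (Sub (<<row_seq M>>%VS : {vspace _}) dM : Gr R r n).
rewrite /frame SubK basisEfree -/(val (row_seq M)) fM subvv /=.
by rewrite (eqP (fM : free _)).
Qed.

Lemma frame_unique M M' V : frame M V -> frame M' V ->
  exists2 g, g \in unitmx & M' = g *m M.
Proof.
move=> fM fM'.
pose g : 'M[R]_r := \matrix_(i, j) coord (row_seq M) j (row i M').
have M'E : M' = g *m M.
  apply/row_matrixP => i; rewrite row_mul mulmx_sum_row.
  have : row i M' \in val V.
    by apply: (basis_mem fM'); apply: map_f; rewrite mem_enum.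
  move=> /(coord_basis (fM : basis_of _ (row_seq M))) {1}->.
  by apply: eq_bigr => j _; rewrite nth_row_seq !mxE.
exists g => //.
rewrite -row_free_unit -row_leq_rank.
by have := frame_row_free fM'; rewrite -row_leq_rank {1}M'E => /leq_trans; apply;
  exact: mxrankM_maxl.
Qed.

Lemma frame_mull g M V : g \in unitmx -> frame M V -> frame (g *m M) V.
Proof.
move=> gU fM; have fgM : free (row_seq (g *m M)).
  rewrite free_row_seq; apply/eqP; rewrite mxrankMfree ?(frame_row_free fM) //.
  by apply/eqP; rewrite -/(row_free g) row_free_unit.
rewrite /frame -/(val (row_seq (g *m M))) basisEfree fgM /=.
apply/andP; split; last by rewrite (eqP (valP V)) size_map size_enum_ord.
apply/span_subvP => _ /mapP[i _ ->]; rewrite row_mul mulmx_sum_row.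
apply: memv_suml => j _; apply: memvZ; apply: (basis_mem fM).
by apply: map_f; rewrite mem_enum.
Qed.

Lemma plucker_frame M V : frame M V ->
  exists2 c : R, c != 0 & forall K, #|K| = r -> plucker V K = c * max_minor M K.
Proof.
move=> fM; have [g gU gE] := frame_unique fM (frame_vbasis V).
exists (\det g) => [|K Kr]; first by rewrite -unitfE -unitmxE.
by rewrite -max_minor_mull // -gE.
Qed.

Lemma row_free_max_minor M : row_free M <->
  exists2 K : {set 'I_n}, #|K| = r & max_minor M K != 0.
Proof.
split=> [fM|[K Kr nz]].
  have fT : row_full M^T by rewrite /row_full mxrank_tr.
  pose f := fullrankfun fT.
  have fI : injective f by exact: fullrankfun_inj.
  pose s := [seq f i | i <- enum 'I_r].
  have sr : size s = r by rewrite size_map size_enum_ord.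
  have us : uniq s by rewrite map_inj_uniq ?enum_uniq.
  exists [set x in s]; first by rewrite cardsE (card_uniqP us).
  rewrite -normr_eq0; have := row_minor_absE M^T sr; rewrite us mul1r => <-.
  rewrite normr_eq0; have : rowsub f M^T \in unitmx by exact: fullrowsub_unit.
  rewrite unitmxE unitfE; congr (_ != 0); rewrite /row_minor.
  congr (\det _); apply/matrixP => i j; rewrite !mxE.
  rewrite (nth_map (f i)) ?sr // (nth_map i) ?size_enum_ord //.
  by rewrite nth_ord_enum mxE.
have sK : size (enum K) = r by rewrite -cardE.
have [x0|e] : 'I_n + (K = finset.set0).
- by case: (pickP (mem K)) => [x _|K0]; [left|right; apply/setP => x; rewrite inE; apply: K0].
- move: nz; rewrite /max_minor (row_minorE _ x0) // -unitfE -unitmxE.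
  rewrite -row_free_unit -!row_leq_rank => h; rewrite -[X in (_ <= X)%N]mxrank_tr.
  apply: leq_trans h _; set f := (X in rowsub X).
have -> : rowsub f M^T = rowsub f 1%:M *m M^T by rewrite mul_rowsub_mx mul1mx.
  exact: mxrankM_maxr.
- by rewrite -row_leq_rank -[X in (X <= _)%N]Kr e cards0.
Qed.

(* A linear change of frame is a homeomorphism, so the union of all
   translates of an open set of matrices descends to Gr. *)
Lemma closure_frame (S : set (Gr R r n)) M V : frame M V -> closure S V ->
  forall O : set 'M[R]_(r, n), open O -> O M ->
  exists M' V', [/\ O M', S V' & frame M' V'].
Proof.
move=> fM clV O oO OM.
pose U : set (Gr R r n) := fun V' => exists2 M', O M' & frame M' V'.
have : nbhs V U.
  apply: open_nbhs_nbhs; split; last by exists M.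
  exists (\bigcup_(g in [set g : 'M[R]_r | g \in unitmx])
            ((fun N => g *m N) @^-1` O))%classic.
    apply: bigcup_open => g _; apply: open_comp oO => N _.
    apply: (@cvg_mx R _ (nbhs N) _ r n (mulmx g)) => i j; rewrite mxE.
    under eq_fun do rewrite mxE.
    apply: cvg_bigsum => l; apply: cvgM; [exact: cvg_cst | exact: coord_continuous].
  move=> N W fN; split=> [[g gU ON]|[N' ON' fN']].
    by exists (g *m N) => //; exact: frame_mull.
  have [g gU gE] := frame_unique fN fN'.
  by exists g => //=; rewrite -gE.
move=> /clV[V' [SV' [M' OM' fM']]].
by exists M', V'.
Qed.

Lemma frame_closure (S : set (Gr R r n)) M V : frame M V ->
  (forall O : set 'M[R]_(r, n), open O -> O M ->
    exists M' V', [/\ O M', S V' & frame M' V']) -> closure S V.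
Proof.
move=> fM h B; rewrite nbhsE => -[U [[O oO OU] UV] UB].
have [M' [V' [OM' SV' fM']]] := h O oO ((OU _ _ fM).2 UV).
by exists V'; split => //; apply: UB; apply/(OU _ _ fM').
Qed.
End Frames.

(** * Rank 2 positroids and their necklaces *)

Section CyclicOrder.
Variable n : nat.
Implicit Types (a b i j l : 'I_n) (N : {set {set 'I_n}}).

Lemma cyc_posE a i : cyc_pos a i = if (a <= i)%N then (i - a)%N else (i + n - a)%N.
Proof.
rewrite /cyc_pos; have ia := ltn_ord a; have ii := ltn_ord i.
case: leqP => ai; last by rewrite modn_small; lia.
rewrite (_ : i + (n - a) = i - a + n)%N; last by lia.
by rewrite modnDr modn_small; lia.
Qed.

Lemma cyc_pos_inside i l b : (i < l)%N -> (l < b)%N ->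
  (0 < cyc_pos i l < cyc_pos i b)%N.
Proof.
by move=> il lb; rewrite !cyc_posE (ltnW il) (ltnW (ltn_trans il lb)); lia.
Qed.

Lemma cyc_pos_after i l b : (b < i)%N -> (i < l)%N ->
  (0 < cyc_pos i l < cyc_pos i b)%N.
Proof.
move=> bi il; rewrite !cyc_posE (ltnW il) [(i <= b)%N]leqNgt bi /=.
by have := ltn_ord l; lia.
Qed.

Lemma cyc_pos_before i l b : (b < i)%N -> (l < b)%N ->
  (0 < cyc_pos i l < cyc_pos i b)%N.
Proof.
move=> bi lb; have := ltn_ord i; rewrite !cyc_posE [(i <= l)%N]leqNgt.
by rewrite [(i <= b)%N]leqNgt bi (ltn_trans lb bi) /=; lia.
Qed.

Lemma cyc_pos_inj a : injective (cyc_pos a).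
Proof.
move=> i j; rewrite !cyc_posE; have := ltn_ord i; have := ltn_ord j; have := ltn_ord a.
move=> ? ? ? e; apply: val_inj => /=; move: e.
by case: (leqP a i) => ?; case: (leqP a j) => ?; lia.
Qed.

Lemma cyc_word2 a i j : (cyc_pos a i < cyc_pos a j)%N ->
  cyc_word a [set i; j] = [:: cyc_pos a i; cyc_pos a j] :> seq nat.
Proof.
move=> ltij; have nij : i != j by apply: contraTneq ltij => ->; rewrite ltnn.
rewrite /cyc_word.
transitivity (sort leq [:: cyc_pos a i; cyc_pos a j]); last first.
  by rewrite sorted_sort //=; [exact: leq_trans | rewrite ltnW].
apply/(perm_sortP leq_total leq_trans anti_leq).
rewrite -[X in perm_eq _ X]/(map (cyc_pos a) [:: i; j]) perm_map //.
rewrite uniq_perm ?enum_uniq //= ?inE ?nij // => x.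
by rewrite mem_enum !inE.
Qed.

Lemma cyc_pos_pair a (I : {set 'I_n}) : #|I| = 2 ->
  exists i j, I = [set i; j] /\ (cyc_pos a i < cyc_pos a j)%N.
Proof.
move=> /eqP/cards2P[i [j [nij ->]]].
have : cyc_pos a i != cyc_pos a j by rewrite (inj_eq (@cyc_pos_inj a)).
rewrite neq_ltn => /orP[lt|lt]; first by exists i, j.
by exists j, i; rewrite finset.setUC.
Qed.

Definition first_partner N i b :=
  [set i; b] \in N /\
  forall l, (0 < cyc_pos i l < cyc_pos i b)%N -> [set i; l] \notin N.

Section Necklace.
Variables (N : {set {set 'I_n}}).
Hypothesis N2 : forall I, I \in N -> #|I| = 2.

Lemma necklace_min a I0 : I0 \in N ->
  necklace N a \in N /\
  forall J, J \in N -> (cyc_word a (necklace N a) <= cyc_word a J)%O.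
Proof.
move=> I0N; rewrite /necklace; case: pickP => [I /andP[IN /forall_inP h]|no] /=.
  by split.
case: (arg_minP (fun I : {set 'I_n} => cyc_word a I) I0N) => I IN h.
by have /negP := negbT (no I); case; apply/andP; split => //; apply/forall_inP => J /h.
Qed.

Lemma cyc_word2_le a i j i' j' : (cyc_pos a i < cyc_pos a j)%N ->
  (cyc_pos a i' < cyc_pos a j')%N ->
  (cyc_word a [set i; j] <= cyc_word a [set i'; j'])%O ->
  (cyc_pos a i <= cyc_pos a i')%N &&
  ((cyc_pos a i' <= cyc_pos a i)%N ==> (cyc_pos a j <= cyc_pos a j')%N).
Proof.
move=> lt lt'; rewrite (cyc_word2 lt) (cyc_word2 lt') !lexi_cons !leEnat.
by rewrite lexi0s implybT andbT.
Qed.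

(** Let [i] be the smaller element of the pair in the order from [a]. Between [i] and [b] the orders
    from [a] and from [i] agree, so a basis {i, l} with [l] in between would beat the minimal
    one. *)
Lemma necklace_first_partner a I0 : I0 \in N ->
  exists i b, necklace N a = [set i; b] /\ first_partner N i b.
Proof.
move=> I0N; have [nN nmin] := necklace_min a I0N.
have [i [b [e lt]]] := cyc_pos_pair a (N2 nN).
exists i, b; split=> //; split => [|l ltl]; [by rewrite -e | apply/negP => ilN].
have lt' : (cyc_pos a i < cyc_pos a l)%N && (cyc_pos a l < cyc_pos a b)%N.
  move: ltl lt; rewrite !cyc_posE.
  have := ltn_ord i; have := ltn_ord b; have := ltn_ord l; have := ltn_ord a.
  by case: (leqP i l) => ?; case: (leqP i b) => ?; case: (leqP a i) => ?;
    case: (leqP a b) => ?; case: (leqP a l) => ?; lia.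
case/andP: lt' => lt1 lt2.
have := nmin _ ilN; rewrite e => /(cyc_word2_le lt lt1).
by rewrite leqnn /= leqNgt lt2.
Qed.

(** Pairs containing [i] are exactly those whose word starts with 0, so the minimal basis contains
    [i], and minimality then decides its second element. *)
Lemma first_partner_necklace i b : first_partner N i b ->
  necklace N i = [set i; b].
Proof.
move=> [ibN first]; have [nN nmin] := necklace_min i ibN.
have [x [y [e lt]]] := cyc_pos_pair i (N2 nN).
have pii : cyc_pos i i = 0%N by rewrite cyc_posE leqnn subnn.
have nib : i != b.
  by apply: contra_eq_neq (N2 ibN) => ->; rewrite finset.setUid cards1.
have lt0 : (cyc_pos i i < cyc_pos i b)%N.
  by rewrite ltn_neqAle (inj_eq (@cyc_pos_inj i)) nib pii.
have := nmin _ ibN; rewrite e => /(cyc_word2_le lt lt0).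
rewrite {1}pii leqn0 => /andP[/eqP x0].
have xi : x = i by apply: (@cyc_pos_inj i); rewrite x0.
subst x; rewrite leqnn /= => yb; congr [set i; _].
apply: (@cyc_pos_inj i); apply/eqP; rewrite eqn_leq yb /= leqNgt.
apply/negP => yb'; have := first y; rewrite -e nN -pii lt yb'.
by move=> /(_ isT).
Qed.

Lemma exists_first_partner i j : [set i; j] \in N ->
  exists2 b, first_partner N i b & (cyc_pos i b <= cyc_pos i j)%N.
Proof.
move=> ijN; pose P b := [set i; b] \in N.
case: (@arg_minnP _ j P (cyc_pos i) ijN) => b bN bmin.
exists b; last exact: bmin.
split => // l /andP[_ lb]; apply/negP => /bmin; by rewrite leqNgt lb.
Qed.

End Necklace.
End CyclicOrder.

(** * Brackets, nonnegative frames and noncrossing in rank 2 *)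

Section RankTwo.
Variables (R : realType) (n : nat).
Implicit Types (u : 'M[R]_(2, n)) (x y i j : 'I_n) (N : {set {set 'I_n}}).

(** The antisymmetric form of [max_minor] on pairs; in it the Plücker relations are polynomial
    identities with no case distinction on the order of the columns. *)
Definition bracket u x y := u 0 x * u 1 y - u 0 y * u 1 x.

Lemma bracketC u x y : bracket u x y = - bracket u y x.
Proof. by rewrite /bracket; ring. Qed.

Lemma enum_pair x y : (x < y)%N -> enum [set x; y] = [:: x; y].
Proof.
by move=> xy; symmetry; apply: enum_set_eq => [|z]; rewrite ?inE //= andbT.
Qed.

Lemma det2 (g : 'M[R]_2) : \det g = g 0 0 * g 1 1 - g 0 1 * g 1 0.
Proof.
rewrite (expand_det_row _ 0) !big_ord_recl big_ord0 addr0.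
rewrite /cofactor !det_mx11 !mxE /= expr0 mul1r expr1 mulN1r mulrN.
by congr (g _ _ * g _ _ - g _ _ * g _ _); apply: val_inj.
Qed.

Lemma row_minor2 (A : 'M[R]_(n, 2)) x y :
  row_minor A [:: x; y] = A x 0 * A y 1 - A x 1 * A y 0.
Proof. by rewrite /row_minor det2 !mxE. Qed.

Lemma max_minor_bracket u x y : (x < y)%N ->
  max_minor u [set x; y] = bracket u x y.
Proof.
by move=> xy; rewrite /max_minor enum_pair // row_minor2 !mxE /bracket; ring.
Qed.

Lemma max_minor_bracket_neq0 u x y : x != y ->
  (max_minor u [set x; y] != 0) = (bracket u x y != 0).
Proof.
rewrite -val_eqE neq_ltn => /orP[lt|lt]; first by rewrite max_minor_bracket.
by rewrite finset.setUC max_minor_bracket // bracketC oppr_eq0.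
Qed.

Definition tnn_matrix r (M : 'M[R]_(r, n)) :=
  forall K : {set 'I_n}, #|K| = r -> 0 <= max_minor M K.

Definition matroid_mx r (M : 'M[R]_(r, n)) : {set {set 'I_n}} :=
  [set K : {set 'I_n} | (#|K| == r) && (max_minor M K != 0)].

Lemma matroid_of_frame r (M : 'M[R]_(r, n)) V : frame M V ->
  matroid_of V = matroid_mx M.
Proof.
move=> /plucker_frame [c c0 cM]; apply/setP => K; rewrite !inE.
by case: eqP => //= /cM ->; rewrite mulf_eq0 (negPf c0).
Qed.

Lemma row_free_matroid r (M : 'M[R]_(r, n)) : row_free M -> exists K, K \in matroid_mx M.
Proof.
by case/row_free_max_minor => K Kr nz; exists K; rewrite inE Kr eqxx.
Qed.

(** Meant to absorb the common scalar of [Gr_tnn], and later the constant of duality. A single row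
    is scaled, hence [0 < r]. *)
Lemma scale_row_minors r (M : 'M[R]_(r, n)) (c : R) : (0 < r)%N ->
  exists M' : 'M[R]_(r, n), exists2 g : 'M[R]_r, M' = g *m M &
    \det g = c /\ forall K : {set 'I_n}, #|K| = r -> max_minor M' K = c * max_minor M K.
Proof.
case: r M => // r M _.
pose g : 'M[R]_r.+1 := diag_mx (\row_i (if i == 0 then c else 1)).
have dg : \det g = c.
  rewrite det_diag big_ord_recl !mxE eqxx big1 ?mulr1 // => i _.
  by rewrite mxE.
by exists (g *m M), g => //; split => // K Kr; rewrite max_minor_mull // dg.
Qed.

Lemma tnn_frame r (V : Gr R r n) : (0 < r)%N -> Gr_tnn V ->
  exists2 M, frame M V & tnn_matrix M.
Proof.
move=> r0 [c c0 cV]; pose B : 'M[R]_(r, n) := \matrix_(i < r) (vbasis (val V))`_i.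
have fB : frame B V by exact: frame_vbasis.
have [M [g gM [dg MK]]] := scale_row_minors B c r0.
exists M; last by move=> K Kr; rewrite MK //; exact: cV.
by rewrite gM; apply: frame_mull => //; rewrite unitmxE unitfE dg.
Qed.

Lemma frame_tnn r (V : Gr R r n) (M : 'M[R]_(r, n)) :
  frame M V -> tnn_matrix M -> Gr_tnn V.
Proof.
move=> /plucker_frame [c c0 cM] tM; exists c^-1; first by rewrite invr_neq0.
by move=> K Kr; rewrite cM // mulKf //; exact: tM.
Qed.

Lemma positroid_mxP r N : (0 < r)%N ->
  positroids R r N <->
  exists2 M : 'M[R]_(r, n), row_free M /\ tnn_matrix M & N = matroid_mx M.
Proof.
move=> r0; split=> [[V tV ->]|[M [fM tM] ->]].
  have [M fM tM] := tnn_frame r0 tV; exists M; last exact: matroid_of_frame.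
  by split => //; exact: frame_row_free fM.
have [V MV] := row_free_frame fM; exists V; first exact: frame_tnn MV tM.
by rewrite (matroid_of_frame MV).
Qed.

Lemma mem_matroid2 u i j : ([set i; j] \in matroid_mx u) = (bracket u i j != 0).
Proof.
rewrite inE; have [->|nij] := eqVneq i j.
  by rewrite finset.setUid cards1 /bracket subrr eqxx.
by rewrite cards2 nij max_minor_bracket_neq0.
Qed.

Lemma tnn_bracket u i j : tnn_matrix u -> (i < j)%N -> 0 <= bracket u i j.
Proof.
move=> tu ij; rewrite -max_minor_bracket //; apply: tu.
by rewrite cards2 -val_eqE (ltn_eqF ij).
Qed.

(** Three-term Plücker relation for the cyclically ordered i, b, j, b'. In each of the four ways to
    cut the cycle into a linear order, the two products on the right have the same weak sign; if
    [bracket u i j] were 0 they would have to cancel, although the first is nonzero. *)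
Lemma tnn_noncrossing u i b j b' : tnn_matrix u ->
  (0 < cyc_pos i b < cyc_pos i j)%N -> (0 < cyc_pos j b' < cyc_pos j i)%N ->
  bracket u i b != 0 -> bracket u j b' != 0 -> bracket u i j != 0.
Proof.
move=> tu c1 c2 n1 n2; apply/negP => /eqP e.
have pl : bracket u i j * bracket u b b' =
    bracket u i b * bracket u j b' + bracket u i b' * bracket u b j.
  by rewrite /bracket; ring.
have pos x y : (x < y)%N -> 0 <= bracket u x y by exact: tnn_bracket.
have neg x y : (y < x)%N -> bracket u x y <= 0.
  by move=> ?; rewrite bracketC oppr_le0; exact: pos.
have nz : bracket u i b * bracket u j b' != 0 by rewrite mulf_neq0.
have : [\/ (i < b < j)%N && (j < b')%N, (b < j < b')%N && (b' < i)%N,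
           (j < b' < i)%N && (i < b)%N | (b' < i < b)%N && (b < j)%N].
  move: c1 c2; rewrite !cyc_posE.
  have := ltn_ord i; have := ltn_ord b; have := ltn_ord j; have := ltn_ord b'.
  have [?|?] := leqP i b; have [?|?] := leqP i j; have [?|?] := leqP j b';
    have [?|?] := leqP j i => ? ? ? ? ? ?;
    first [by apply: Or41; lia | by apply: Or42; lia | by apply: Or43; lia
          | by apply: Or44; lia | lia].
move: pl; rewrite e mul0r; move: nz.
have sgn (p q r s : R) : [\/ 0 <= p * q /\ 0 <= r * s | p * q <= 0 /\ r * s <= 0] ->
    p * q != 0 -> 0 = p * q + r * s -> False.
  move=> h; set P := p * q in h *; set Q := r * s in h *; move=> /eqP; lra.
move=> nz pl; case=> /andP[/andP[h1 h2] h3]; apply: (sgn _ _ _ _ _ nz pl).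
- by left; split; apply: mulr_ge0; apply: pos; lia.
- right; split; [apply: mulr_le0_ge0 | apply: mulr_le0_ge0];
    first [apply: pos; lia | apply: neg; lia].
- left; split; [apply: mulr_ge0 | apply: mulr_le0];
    first [apply: pos; lia | apply: neg; lia].
- right; split; [apply: mulr_ge0_le0 | apply: mulr_le0_ge0];
    first [apply: pos; lia | apply: neg; lia].
Qed.

Lemma positroid_noncrossing N i b j b' : positroids R 2 N ->
  (0 < cyc_pos i b < cyc_pos i j)%N -> (0 < cyc_pos j b' < cyc_pos j i)%N ->
  [set i; b] \in N -> [set j; b'] \in N -> [set i; j] \in N.
Proof.
by move=> /positroid_mxP[] // u [_ tu] ->; rewrite !mem_matroid2; exact: tnn_noncrossing.
Qed.

Lemma positroid_card r N I : positroids R r N -> I \in N -> #|I| = r.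
Proof. by move=> [V _ ->]; rewrite inE => /andP[/eqP]. Qed.

Lemma positroid_neq0 r N : positroids R r N -> exists I, I \in N.
Proof.
move=> [V _ ->]; have fM := frame_vbasis V.
have [K] := row_free_matroid (frame_row_free fM).
by rewrite (matroid_of_frame fM); exists K.
Qed.

(** Were {i, j} in [N] but not in [N'], the first partners of [i] and of [j] would lie strictly
    inside the two opposite arcs, and noncrossing in [N'] would put {i, j} into [N']. The family [N]
    may be any set of pairs. *)
Lemma sub_of_first_partners N N' : positroids R 2 N' ->
  (forall I, I \in N -> #|I| = 2) ->
  (forall i b, first_partner N i b -> [set i; b] \in N') -> N \subset N'.
Proof.
move=> pN' N2 h; apply/fintype.subsetP => I IN.
have /eqP/cards2P[i [j [nij eI]]] := N2 _ IN; rewrite eI in IN *.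
have step x y : [set x; y] \in N -> x != y -> [set x; y] \notin N' ->
    exists2 b, (0 < cyc_pos x b < cyc_pos x y)%N & [set x; b] \in N'.
  move=> xyN nxy xyN'; have [b fb bj] := exists_first_partner xyN.
  exists b; last exact: h.
  have pxx : cyc_pos x x = 0%N by rewrite cyc_posE leqnn subnn.
  rewrite [(_ < cyc_pos x y)%N]ltn_neqAle bj andbT -pxx ltn_neqAle !(inj_eq (@cyc_pos_inj _ _)).
  rewrite pxx leq0n andbT; apply/andP; split.
    by apply: contra_eq_neq (N2 _ fb.1) => <-; rewrite finset.setUid cards1.
  by apply: contraNneq xyN' => <-; exact: h.
apply/negPn/negP => ijN'.
have [b c1 b1] := step _ _ IN nij ijN'.
have [b' c2 b2] : exists2 b', (0 < cyc_pos j b' < cyc_pos j i)%N & [set j; b'] \in N'.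
  by apply: step; rewrite 1?eq_sym // finset.setUC.
by move: ijN'; rewrite (positroid_noncrossing pN' c1 c2 b1 b2).
Qed.

(** Passes from the necklace and [plucker] to first partners and a chosen frame; the necklace itself
    is not met again. *)
Lemma open_positroidP N u W : positroids R 2 N -> frame u W ->
  open_positroid_variety N W <->
  matroid_mx u \subset N /\
  (forall i b, first_partner N i b -> [set i; b] \in matroid_mx u).
Proof.
move=> pN fu; have [c c0 cu] := plucker_frame fu.
have N2 I : I \in N -> #|I| = 2 by exact: positroid_card pN.
have [I0 I0N] := positroid_neq0 pN.
split=> [[v o]|[sub o]].
  split=> [|i b fb].
    apply/fintype.subsetP => I; rewrite inE => /andP[/eqP I2]; apply: contraR => IN.
    by have := v I I2 IN; rewrite cu // => /eqP; rewrite mulf_eq0 (negPf c0).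
  have := o i; rewrite (first_partner_necklace N2 fb) cu ?(N2 _ fb.1) //.
  by rewrite mulf_eq0 (negPf c0) /= inE (N2 _ fb.1) eqxx.
split=> [I I2 IN|a].
  rewrite cu //; apply/eqP; rewrite mulf_eq0 (negPf c0) /=.
  by apply: contraNT IN => nz; apply: (fintype.subsetP sub); rewrite inE I2 eqxx.
have [i [b [-> fb]]] := necklace_first_partner N2 a I0N.
have := o _ _ fb; rewrite inE => /andP[/eqP I2 nz].
by rewrite cu // mulf_neq0.
Qed.

End RankTwo.

(** * Signs of twistor coordinates *)

Section OrdinalCounting.
Variable n : nat.
Implicit Types A : {set 'I_n}.

Lemma card_ord_below c : (c <= n)%N -> #|[set l : 'I_n | (l < c)%N]| = c.
Proof.
move=> cn; rewrite -sum1_card (eq_bigl (fun l : 'I_n => (l < c)%N)); last first.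
  by move=> l; rewrite inE.
by rewrite -(big_ord_widen n (fun=> 1%N) cn) sum1_card card_ord.
Qed.

Lemma card_split_at A c :
  (#|[set l in A | (l < c)%N]| + #|[set l in A | (c <= l)%N]|)%N = #|A|.
Proof.
rewrite -(cardsID [set l : 'I_n | (l < c)%N] A); congr addn; apply: eq_card => l.
  by rewrite !inE.
by rewrite !inE -leqNgt andbC.
Qed.

(* The right-hand side does not involve [K]: by [minor_KI_sign] this parity is
   the sign of [minor_KI Z K [set i; b]]. *)
Lemma count_below_cyclic (K : {set 'I_n}) i b k : #|K| = k ->
  i \notin K -> b \notin K -> i != b ->
  (forall l, (0 < cyc_pos i l < cyc_pos i b)%N -> l \in K) ->
  odd (#|[set l in K | (l < i)%N]| + #|[set l in K | (l < b)%N]|) =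
  odd (if (i < b)%N then b - i - 1 else k + n - i - 1 + b)%N.
Proof.
move=> Kk iK bK nib h; have ii := ltn_ord i; have bb := ltn_ord b.
case: ltnP => [ib|bi].
  have e1 := card_split_at [set l in K | (l < b)%N] i.
  have e2 := card_split_at [set l : 'I_n | (l < b)%N] i.+1.
  rewrite card_ord_below ?(ltnW bb) // in e2.
  rewrite (_ : [set l in [set l in K | (l < b)%N] | (l < i)%N] =
    [set l in K | (l < i)%N]) in e1; last first.
    by apply/setP => l; rewrite !inE -andbA; congr andb; lia.
  rewrite (_ : [set l in [set l : 'I_n | (l < b)%N] | (l < i.+1)%N] =
    [set l : 'I_n | (l < i.+1)%N]) in e2; last by apply/setP => l; rewrite !inE; lia.
  rewrite card_ord_below // in e2.
  have e3 : [set l in [set l in K | (l < b)%N] | (i <= l)%N] =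
      [set l in [set l : 'I_n | (l < b)%N] | (i < l)%N].
    apply/setP => l; rewrite !inE; have [lb|_] := ltnP l b; rewrite ?andbF //= andbT.
    apply/andP/idP => [[lK il]|il].
      rewrite ltn_neqAle il andbT val_eqE; by apply: contraNneq iK => ->.
    split; last exact: ltnW.
    exact/h/cyc_pos_inside.
  have aux (x y a u v : nat) : (v < u)%N -> (x + a = y)%N -> (v.+1 + a = u)%N ->
    odd (x + y) = odd (u - v - 1) by lia.
  by rewrite e3 in e1; exact: aux ib e1 e2.
have {}bi : (b < i)%N by rewrite ltn_neqAle bi andbT eq_sym.
have e1 := card_split_at K i.
have e2 := card_split_at [set l : 'I_n | true] i.+1.
rewrite (_ : [set l in [set l : 'I_n | true] | (l < i.+1)%N] =
    [set l : 'I_n | (l < i.+1)%N]) in e2; last by apply/setP => l; rewrite !inE.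
rewrite card_ord_below // in e2.
have e0 : #|[set l : 'I_n | true]| = n by rewrite cardsE card_ord.
rewrite e0 in e2.
have e3 : [set l in K | (i <= l)%N] = [set l in [set l : 'I_n | true] | (i < l)%N].
  apply/setP => l; rewrite !inE /=; apply/andP/idP => [[lK il]|il].
    by rewrite ltn_neqAle il andbT val_eqE; apply: contraNneq iK => ->.
  split; last exact: ltnW.
  exact/h/cyc_pos_after.
have e4 : [set l in K | (l < b)%N] = [set l : 'I_n | (l < b)%N].
  apply/setP => l; rewrite !inE; have [lb|_] := ltnP l b; rewrite ?andbF //= andbT.
  exact/h/cyc_pos_before.
have e5 : #|[set l in K | (l < b)%N]| = b by rewrite e4 card_ord_below // ltnW.
have aux (x a m v : nat) : (x + a = k)%N -> (v.+1 + a = m)%N ->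
  odd (x + b) = odd (k + m - v - 1 + b) by lia.
by rewrite e5; apply: aux e2; rewrite -e3 e1.
Qed.

End OrdinalCounting.

Section Twistor.
Variables (R : realType) (n k : nat) (Z : 'M[R]_(n, k.+2)).
Implicit Types (p : {set 'I_n} -> R) (K I : {set 'I_n}) (i j l b : 'I_n).

(** Frees [twistor_coord] from a point of the Grassmannian: [p] can be the minors of a frame, or the
    complementary minors of a dual matrix. *)
Definition twistor_sum p I : R :=
  \sum_(K : {set 'I_n} | #|K| == k) p K * minor_KI Z K I.

Lemma minor_KI_cat K I : #|K| = k -> #|I| = 2 ->
  minor_KI Z K I = row_minor Z (enum K ++ enum I).
Proof.
move=> Kk I2; rewrite /minor_KI; case: ifP => // /negbT nd.
rewrite row_minor_notuniq //; first by rewrite size_cat -!cardE Kk I2 addn2.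
rewrite cat_uniq !enum_uniq /= andbT negbK.
case/pred0Pn: nd => x /andP[xK xI].
by apply/hasP; exists x; rewrite /= mem_enum.
Qed.

(** Bringing [i] and then [j] to the front costs [k] and [k.+1] transpositions, and sorting them in
    again costs the two counts, where [i] itself is an extra element below [j]. The extra ones and
    the two [k] cancel modulo 2. *)
Lemma minor_KI_sign K i j : #|K| = k -> (i < j)%N -> i \notin K -> j \notin K ->
  minor_KI Z K [set i; j] =
  (-1) ^+ (#|[set l in K | (l < i)%N]| + #|[set l in K | (l < j)%N]|) *
  row_minor Z (enum (j |: (i |: K))).
Proof.
move=> Kk ij iK jK; have nij : i != j by rewrite -val_eqE (ltn_eqF ij).
rewrite minor_KI_cat ?cards2 ?nij // enum_pair //.
have jiK : j \notin i |: K by rewrite !inE eq_sym (negPf nij).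
have m1 : row_minor Z ([::] ++ i :: enum K ++ [:: j]) =
    (-1) ^+ k * row_minor Z (enum K ++ [:: i; j]).
  by rewrite row_minor_move -?cardE ?Kk //= size_cat -cardE Kk addn1.
rewrite row_minor_insert // in m1; last by rewrite /= size_cat -cardE Kk addn1.
have m2 : row_minor Z ([::] ++ j :: enum (i |: K) ++ [::]) =
    (-1) ^+ k.+1 * row_minor Z (enum (i |: K) ++ [:: j]).
  rewrite row_minor_move -?cardE ?cardsU1 ?iK ?Kk ?add1n //.
  by rewrite /= size_cat -cardE cardsU1 iK Kk addn0.
rewrite row_minor_insert // in m2; last by rewrite /= size_cat -cardE cardsU1 iK Kk addn0.
rewrite /= cats0 in m1 m2.
have c1 : #|[set y in i |: K | (y < j)%N]| = #|[set l in K | (l < j)%N]|.+1.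
  rewrite -add1n (_ : [set y in i |: K | (y < j)%N] = i |: [set l in K | (l < j)%N]).
    by rewrite cardsU1 !inE (negPf iK).
  by apply/setP => y; rewrite !inE; have [->|] := eqVneq y i; rewrite ?ij.
rewrite c1 in m2; move: m1 m2.
set a := #|[set l in K | (l < i)%N]|; set c := #|[set l in K | (l < j)%N]|.
set X := row_minor _ (enum K ++ _).
set Y := row_minor _ (enum (i |: K) ++ _); set W := row_minor _ _ => m1 m2.
have sq (m : nat) : (-1) ^+ m * (-1) ^+ m = 1 :> R by rewrite -exprMn mulrNN mulr1 expr1n.
have -> : X = (-1) ^+ k * ((-1) ^+ a * Y) by rewrite m1 mulrA sq mul1r.
have -> : Y = (-1) ^+ k.+1 * ((-1) ^+ c.+1 * W) by rewrite m2 mulrA sq mul1r.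
rewrite exprD !exprS; have := sq k.
move: ((-1) ^+ k : R) ((-1) ^+ a : R) ((-1) ^+ c : R) => x y z xx.
by transitivity ((x * x) * (y * z * W)); [ring | rewrite xx mul1r].
Qed.

Hypothesis Zpos : forall J : {set 'I_n}, #|J| = k.+2 -> 0 < row_minor Z (enum J).

Section Nonneg.
Variable p : {set 'I_n} -> R.
Hypothesis p_ge0 : forall K, #|K| = k -> 0 <= p K.

Lemma twistor_sum_no_cancel i b : i != b -> twistor_sum p [set i; b] = 0 ->
  (forall K l, #|K| = k -> p K != 0 -> i \notin K ->
     (0 < cyc_pos i l < cyc_pos i b)%N -> l \in K) ->
  forall K, #|K| = k -> p K != 0 -> i \notin K -> b \in K.
Proof.
move=> nib s0 h K Kk pK iK; apply/negPn/negP => bK.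
pose s := odd (if (i < b)%N then b - i - 1 else k + n - i - 1 + b)%N.
have sE K' : #|K'| = k -> p K' != 0 -> i \notin K' -> b \notin K' ->
    exists2 m, 0 < m & minor_KI Z K' [set i; b] = (-1) ^+ s * m.
  move=> K'k pK' iK' bK'.
  have par := count_below_cyclic K'k iK' bK' nib (fun l => h K' l K'k pK' iK').
  have := nib; rewrite -val_eqE neq_ltn => /orP[lt|lt].
    exists (row_minor Z (enum (b |: (i |: K')))).
      by apply: Zpos; rewrite !cardsU1 !inE eq_sym negb_or nib iK' bK' K'k.
    by rewrite minor_KI_sign // -signr_odd par.
  exists (row_minor Z (enum (i |: (b |: K')))).
    by apply: Zpos; rewrite !cardsU1 !inE negb_or nib iK' bK' K'k.
  by rewrite finset.setUC minor_KI_sign // -signr_odd addnC par.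
have t_ge0 K' : #|K'| == k -> 0 <= p K' * ((-1) ^+ s * minor_KI Z K' [set i; b]).
  move=> /eqP K'k; have [->|pK'] := eqVneq (p K') 0; first by rewrite mul0r.
  have [d|nd] := boolP [disjoint K' & [set i; b]]; last first.
    by rewrite /minor_KI (negPf nd) !mulr0.
  have ni x : x \in [set i; b] -> x \notin K'.
    by move=> xI; move: d; rewrite disjoint_sym disjoint_subset => /fintype.subsetP/(_ _ xI).
  have [m m0 ->] := sE K' K'k pK' (ni i (set21 _ _)) (ni b (set22 _ _)).
  by rewrite [X in _ * X]mulrA -signr_addb addbb mul1r mulr_ge0 ?p_ge0 // ltW.
have : \sum_(K' : {set 'I_n} | #|K'| == k)
    p K' * ((-1) ^+ s * minor_KI Z K' [set i; b]) = 0.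
  under eq_bigr do rewrite mulrCA.
  by rewrite -mulr_sumr -/(twistor_sum p _) s0 mulr0.
move=> /eqP; rewrite psumr_eq0 // => /allP/(_ K); rewrite mem_index_enum => /(_ isT).
have [m m0 ->] := sE K Kk pK iK bK.
rewrite Kk eqxx /= [X in _ * X]mulrA -signr_addb addbb mul1r mulf_eq0 (negPf pK) /=.
by rewrite gt_eqF.
Qed.

Lemma twistor_sum_interval i j :
  (forall l, (0 < cyc_pos i l <= cyc_pos i j)%N -> twistor_sum p [set i; l] = 0) ->
  forall K l, #|K| = k -> p K != 0 -> i \notin K ->
    (0 < cyc_pos i l <= cyc_pos i j)%N -> l \in K.
Proof.
move=> h K l Kk pK iK; have [m] := ubnP (cyc_pos i l).
elim: m l K Kk pK iK => // m IH l K Kk pK iK lm lj.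
have nil : i != l.
  by apply: contraTneq lj => <-; rewrite cyc_posE leqnn subnn.
apply: (twistor_sum_no_cancel nil (h l lj)) => // K' l' K'k pK' iK' /andP[l0 l'l].
apply: IH => //; first exact: leq_trans l'l _.
by case/andP: lj => _ lj; rewrite l0 (ltnW (leq_trans l'l lj)).
Qed.

(* Either all of (i, j] or all of (j, i] is dependent on its starting point,
   and then there is no cancellation in the corresponding twistor coordinates. *)
Lemma twistor_sum_positroid N : positroids R 2 N ->
  (forall I, #|I| = 2 -> I \notin N -> twistor_sum p I = 0) ->
  forall K i j, #|K| = k -> p K != 0 -> i != j -> i \notin K -> j \notin K ->
    [set i; j] \in N.
Proof.
move=> pN N0 K i j Kk pK nij iK jK; apply/negPn/negP => ijN.
have pos_gt0 x y : x != y -> (0 < cyc_pos x y)%N.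
  have pxx : cyc_pos x x = 0%N by rewrite cyc_posE leqnn subnn.
  by move=> nxy; rewrite lt0n -pxx eq_sym (inj_eq (@cyc_pos_inj _ x)).
have step x y : x != y -> x \notin K -> y \notin K -> [set x; y] \notin N ->
    exists2 b, (0 < cyc_pos x b < cyc_pos x y)%N & [set x; b] \in N.
  move=> nxy xK yK xyN.
  have [/existsP[b /andP[c bN]]|/existsPn no] :=
    boolP [exists b, (0 < cyc_pos x b < cyc_pos x y)%N && ([set x; b] \in N)].
    by exists b.
  case/negP: (yK); apply: (@twistor_sum_interval x y _ K y Kk pK xK).
    move=> l /andP[l0]; rewrite leq_eqVlt => /orP[/eqP/cyc_pos_inj ->|ly].
      by apply: N0 => //; rewrite cards2 nxy.
    apply: N0; last by have := no l; rewrite l0 ly.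
    rewrite cards2; suff -> : x != l by [].
    by apply: contraTneq l0 => <-; rewrite cyc_posE leqnn subnn.
  by rewrite leqnn pos_gt0.
have [b c1 b1] := step _ _ nij iK jK ijN.
have [b' c2 b2] : exists2 b', (0 < cyc_pos j b' < cyc_pos j i)%N & [set j; b'] \in N.
  by apply: step; rewrite // 1?eq_sym // finset.setUC.
by move: ijN; rewrite (positroid_noncrossing pN c1 c2 b1 b2).
Qed.

End Nonneg.

End Twistor.

(** * Faces of the amplituhedron *)

Section Faces.
Variables (R : realType) (n k : nat) (Z : 'M[R]_(n, k.+2)).
Implicit Types (A : 'M[R]_(k, n)) (u : 'M[R]_(2, n)) (N M : {set {set 'I_n}}).

Definition twistor_mx A u := exists2 c : R, c != 0 &
  forall I : {set 'I_n}, #|I| = 2 -> max_minor u I = c * twistor_sum Z (max_minor A) I.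

Lemma twistor_frame A u C W : frame A C -> frame u W ->
  twistor Z C W <-> twistor_mx A u.
Proof.
move=> fA fu; have [a a0 aA] := plucker_frame fA; have [b b0 bu] := plucker_frame fu.
have tE I : twistor_coord Z C I = a * twistor_sum Z (max_minor A) I.
  by rewrite mulr_sumr; apply: eq_bigr => K /eqP Kk; rewrite aA // mulrA.
split=> -[c c0 h].
  exists (b^-1 * (c * a)) => [|I I2]; first by rewrite !mulf_neq0 ?invr_neq0.
  by rewrite -mulrA -[c * a * _]mulrA -tE -h // bu // mulKf.
exists (b * c * a^-1) => [|I I2]; first by rewrite !mulf_neq0 ?invr_neq0.
by rewrite bu // h // tE -!mulrA mulKf.
Qed.

(** The image plane is the image under [Z] of the two-dimensional kernel of [A *m Z], whose minors
    [kernel_minors] identifies with the twistor coordinates. *)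
Lemma exists_twistor A (I : {set 'I_n}) : #|I| = 2 ->
  twistor_sum Z (max_minor A) I != 0 -> exists2 u, row_free u & twistor_mx A u.
Proof.
move=> I2 nz; have sumE (J : {set 'I_n}) : #|J| = 2 -> twistor_sum Z (max_minor A) J =
    \sum_(K : {set 'I_n} | #|K| == k)
      row_minor A^T (enum K) * row_minor Z (enum K ++ enum J).
  by move=> J2; apply: eq_bigr => K /eqP Kk; rewrite minor_KI_cat.
have [x0 _] : exists x0, x0 \in I by apply/set0Pn; rewrite -card_gt0 I2.
rewrite sumE // in nz.
have pk : k.+2 = (k + 2)%N by rewrite addn2.
have sI : size (enum I) = 2 by rewrite -cardE.
have [Y [c c0 h]] := kernel_minors x0 pk sI nz.
pose u : 'M[R]_(2, n) := (Z *m Y)^T.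
have uE (J : {set 'I_n}) : #|J| = 2 ->
    max_minor u J = c * twistor_sum Z (max_minor A) J.
  by move=> J2; rewrite /max_minor trmxK h -?cardE // sumE.
exists u; last by exists c.
by apply/row_free_max_minor; exists I => //; rewrite uE // sumE // mulf_neq0.
Qed.

Lemma amplituhedronP W u : (0 < k)%N -> frame u W ->
  amplituhedron Z W <-> exists A, [/\ row_free A, tnn_matrix A & twistor_mx A u].
Proof.
move=> k0 fu; split=> [[C tC CW]|[A [fA tA Au]]].
  have [A fA tA] := tnn_frame k0 tC; exists A; split => //.
    exact: frame_row_free fA.
  exact/(twistor_frame fA fu).
have [C fC] := row_free_frame fA; exists C; first exact: frame_tnn fC tA.
exact/(twistor_frame fC fu).
Qed.

Lemma mem_down2 M I : I \in down2 M <->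
  #|I| = 2 /\ exists2 K, K \in M & [disjoint K & I].
Proof.
rewrite inE; split=> [/andP[/eqP I2 /exists_inP[_ /imsetP[K KM ->] IK]]|[I2 [K KM d]]].
  by split=> //; exists K => //; rewrite disjoint_sym finset.disjoints_subset.
rewrite I2 eqxx; apply/exists_inP; exists (finset.setC K).
  exact: imset_f.
by rewrite -finset.disjoints_subset disjoint_sym.
Qed.

Lemma twistor_matroid_sub A u : twistor_mx A u ->
  matroid_mx u \subset down2 (matroid_mx A).
Proof.
move=> [c c0 h]; apply/fintype.subsetP => I; rewrite inE => /andP[/eqP I2].
rewrite h // mulf_eq0 (negPf c0) /= => nz; apply/mem_down2; split => //.
have [/existsP[K /andP[/eqP Kk KI]]|/existsPn no] :=
    boolP [exists K : {set 'I_n}, (#|K| == k) && (max_minor A K * minor_KI Z K I != 0)].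
  move: KI; rewrite mulf_eq0 negb_or => /andP[KA KI].
  exists K; first by rewrite inE Kk eqxx.
  by move: KI; rewrite /minor_KI; case: ifP; rewrite ?eqxx.
case/eqP: nz; apply: big1 => K Kk; have := no K; rewrite Kk /= negbK.
by move/eqP.
Qed.

(** A criterion for envelopes that looks only at the first bases of [N]: any positroid containing
    [M] contains these, hence all of [N]. *)
Lemma envelope_between N M : positroids R 2 N -> M \subset N ->
  (forall i b, first_partner N i b -> [set i; b] \in M) -> is_envelope R 2 M N.
Proof.
move=> pN MN h; split => // N' pN' MN'; apply: (sub_of_first_partners pN') => [I|i b fb].
  exact: positroid_card pN.
exact/(fintype.subsetP MN')/h.
Qed.

Lemma envelope_unique M N N' : is_envelope R 2 M N -> is_envelope R 2 M N' -> N = N'.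
Proof.
move=> [pN MN hN] [pN' MN' hN']; apply/eqP; rewrite finset.eqEsubset.
by rewrite hN // hN'.
Qed.

Hypothesis Zpos : forall J : {set 'I_n}, #|J| = k.+2 -> 0 < row_minor Z (enum J).
Hypotheses (k0 : (0 < k)%N) (kn : (k + 2 <= n)%N).

(** This makes the twistor map defined on all nonnegative points. A basis [K] misses two elements
    [i] and [j], as [k + 2 <= n]; if all coordinates vanished, the arc argument starting from [i]
    would force [j] into [K]. *)
Lemma tnn_twistor_neq0 A : row_free A -> tnn_matrix A ->
  exists2 I : {set 'I_n}, #|I| = 2 & twistor_sum Z (max_minor A) I != 0.
Proof.
move=> /row_free_max_minor [K Kk nz] tA.
have : (2 <= #|~: K|)%N by rewrite cardsCs finset.setCK card_ord Kk; lia.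
case/card_gt1P => i [j []]; rewrite !inE => iK jK nij.
have [/existsP[I /andP[/eqP I2 h]]|/existsPn no] :=
    boolP [exists I : {set 'I_n}, (#|I| == 2) && (twistor_sum Z (max_minor A) I != 0)].
  by exists I.
have pii : cyc_pos i i = 0%N by rewrite cyc_posE leqnn subnn.
have : j \in K.
  apply: (twistor_sum_interval Zpos tA (i := i) (j := j)) => // [l /andP[l0 _]|].
    have := no [set i; l]; rewrite cards2; have [il|_] := eqVneq i l.
      by rewrite -il pii in l0.
    by rewrite eqxx /= negbK => /eqP.
  by rewrite leqnn andbT lt0n -pii eq_sym (inj_eq (@cyc_pos_inj _ i)).
by rewrite (negPf jK).
Qed.

Lemma down2_sub_positroid A u N : tnn_matrix A -> twistor_mx A u ->
  positroids R 2 N -> matroid_mx u \subset N -> down2 (matroid_mx A) \subset N.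
Proof.
move=> tA [c c0 h] pN uN; apply/fintype.subsetP => I /mem_down2[I2 [K]].
rewrite inE => /andP[/eqP Kk nz] d; have /eqP/cards2P[i [j [nij eI]]] := I2.
rewrite eI in d I2 *; apply: (twistor_sum_positroid Zpos tA pN _ Kk nz nij) => [J J2 JN||].
- apply: contraNeq JN => Jnz; apply: (fintype.subsetP uN); rewrite inE J2 eqxx.
  by rewrite h // mulf_neq0.
- by move: d; rewrite disjoint_sym finset.disjoints_subset => /fintype.subsetP/(_ i (set21 _ _)); rewrite inE.
- by move: d; rewrite disjoint_sym finset.disjoints_subset => /fintype.subsetP/(_ j (set22 _ _)); rewrite inE.
Qed.

Lemma face_envelope A u W N : tnn_matrix A -> twistor_mx A u -> frame u W ->
  positroids R 2 N -> open_positroid_variety N W ->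
  is_envelope R 2 (down2 (matroid_mx A)) N.
Proof.
move=> tA Au fu pN /(open_positroidP pN fu) [sub first].
apply: envelope_between => //; first exact: down2_sub_positroid Au pN sub.
by move=> i b /first; apply: (fintype.subsetP (twistor_matroid_sub Au)).
Qed.

(* A first partner of [N] in [down2] stays a basis of the image: its interval
   carries only vanishing coordinates, so nothing cancels. *)
Lemma open_positroid_of_down2 A u W N : tnn_matrix A -> twistor_mx A u -> frame u W ->
  positroids R 2 N -> down2 (matroid_mx A) = N -> open_positroid_variety N W.
Proof.
move=> tA Au fu pN dN; apply/(open_positroidP pN fu).
have uN : matroid_mx u \subset N by rewrite -dN; exact: twistor_matroid_sub.
split => // i b [ibN first]; apply/negPn/negP => ibu.
have [c c0 h] := Au.
have I2 : #|[set i; b]| = 2 by exact: positroid_card pN ibN.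
have nib : i != b by move: I2; rewrite cards2; case: eqP.
have ibd : [set i; b] \in down2 (matroid_mx A) by rewrite dN.
have [_ [K]] := (mem_down2 _ _).1 ibd.
rewrite inE => /andP[/eqP Kk nz] d.
have nK x : x \in [set i; b] -> x \notin K.
  by move: d; rewrite disjoint_sym finset.disjoints_subset => /fintype.subsetP/(_ x) /[apply]; rewrite inE.
have tw0 (J : {set 'I_n}) : #|J| = 2 -> J \notin matroid_mx u -> twistor_sum Z (max_minor A) J = 0.
  move=> J2; rewrite inE J2 eqxx /= negbK h // mulf_eq0 (negPf c0) /=.
  by move/eqP.
have pii : cyc_pos i i = 0%N by rewrite cyc_posE leqnn subnn.
suff : b \in K by apply/negP; exact: nK (set22 _ _).
apply: (twistor_sum_interval Zpos tA (i := i) (j := b)) => // [l /andP[l0]||].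
- rewrite leq_eqVlt => /orP[/eqP/cyc_pos_inj ->|lb]; first exact: tw0.
  apply: tw0.
    rewrite cards2; have [il|//] := eqVneq i l; by rewrite -il pii in l0.
  apply: contra (first l _) => [|]; last by rewrite l0 lb.
  exact: (fintype.subsetP uN).
- exact: nK (set21 _ _).
- by rewrite leqnn andbT lt0n -pii eq_sym (inj_eq (@cyc_pos_inj _ i)).
Qed.

End Faces.

(** * Rank 2 positroids as block structures *)

Section Blocks.
Variable n : nat.
Implicit Types (nl tl : pred 'I_n) (t : 'I_n -> 'I_n.+1) (i j l b : 'I_n).

(* A rank 2 positroid: [nl] are the nonloops, [t] numbers the parallel
   classes in the order of their first elements, and [tl] is the part of class
   [0] that lies after all the other classes. *)
Definition block_data nl tl t :=
  (forall i, tl i -> nl i && (t i == ord0)) /\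
  (forall i j, nl i -> nl j -> (i < j)%N -> ~~ tl j -> ~~ tl i && (t i <= t j)%N).

Definition transversal nl t (J : {set 'I_n}) :=
  [forall i in J, nl i] && [forall i in J, forall j in J, (t i == t j) ==> (i == j)].

Lemma transversalP nl t (J : {set 'I_n}) : reflect
  ((forall i, i \in J -> nl i) /\ {in J &, injective t}) (transversal nl t J).
Proof.
apply: (iffP andP) => -[h1 h2]; split.
- by move=> i iJ; exact: (forall_inP h1).
- by move=> i j iJ jJ e; move/forall_inP: h2 => /(_ i iJ)/forall_inP/(_ j jJ)/implyP;
    rewrite e eqxx => /(_ isT)/eqP.
- by apply/forall_inP.
- apply/forall_inP => i iJ; apply/forall_inP => j jJ; apply/implyP => /eqP e.
  by apply/eqP; exact: h2.
Qed.

Definition block_matroid nl t : {set {set 'I_n}} :=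
  [set I : {set 'I_n} | (#|I| == 2) && transversal nl t I].

Lemma mem_block_matroid nl t i j :
  ([set i; j] \in block_matroid nl t) = [&& nl i, nl j & t i != t j].
Proof.
rewrite inE; have [->|nij] := eqVneq i j.
  by rewrite finset.setUid cards1 eqxx !andbF.
rewrite cards2 nij /=; apply/transversalP/and3P => [[h1 h2]|[h1 h2 h3]].
  split; [exact: h1 (set21 _ _) | exact: h1 (set22 _ _) |].
  apply: contra nij => /eqP e; apply/eqP; apply: h2 => //; [exact: set21|exact: set22].
split=> [x|x y]; first by rewrite !inE => /orP[] /eqP ->.
rewrite !inE => /orP[] /eqP -> /orP[] /eqP -> // /eqP; first by rewrite (negPf h3).
by rewrite eq_sym (negPf h3).
Qed.

Variable R : realType.

(** Nonloops become columns (1, t i), with brackets equal to differences of class numbers. Pairs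
    ending in the tail would come out negative, since class 0 then comes last; the sign [e] reverses
    them. *)
Lemma block_positroid nl tl t I0 : block_data nl tl t -> I0 \in block_matroid nl t ->
  positroids R 2 (block_matroid nl t).
Proof.
move=> [T0 T1] I0N.
pose e i : R := (-1) ^+ tl i.
pose u : 'M[R]_(2, n) := \matrix_(a, i)
  (if nl i then e i * (if a == 0 then 1 else (t i)%:R) else 0).
have uE i j : bracket u i j =
    if nl i && nl j then e i * e j * ((t j)%:R - (t i)%:R) else 0.
  rewrite /bracket !mxE; case: (nl i); case: (nl j); rewrite ?mul0r ?mulr0 ?subrr //=.
  ring.
have e0 i : e i != 0 by rewrite /e signr_eq0.
have mE : matroid_mx u = block_matroid nl t.
  apply/setP => I; have [I2|I2] := eqVneq #|I| 2; last by rewrite !inE (negPf I2).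
  have /eqP/cards2P[i [j [nij ->]]] := I2; rewrite mem_matroid2 mem_block_matroid uE.
  case: (nl i); case: (nl j); rewrite ?eqxx //= !mulf_eq0 !(negPf (e0 _)) /=.
  by rewrite subr_eq0 eqr_nat eq_sym.
apply/positroid_mxP => //; exists u; last by rewrite mE.
split.
  apply/row_free_max_minor; exists I0; move: I0N; rewrite -mE inE => /andP[/eqP] //.
move=> K K2; have [i [j [-> ij]]] : exists i j, K = [set i; j] /\ (i < j)%N.
  have /eqP/cards2P[i [j [nij ->]]] := K2.
  move: nij; rewrite -val_eqE neq_ltn => /orP[lt|lt]; first by exists i, j.
  by exists j, i; rewrite finset.setUC.
rewrite max_minor_bracket // uE; case: ifP => // /andP[nli nlj].
have [tj|tj] := boolP (tl j).
  have /andP[_ /eqP tj0] := T0 _ tj; rewrite tj0 /= sub0r /e tj.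
  have [ti|ti] := boolP (tl i); last by rewrite mul1r expr1 mulrNN mul1r ler0n.
  by have /andP[_ /eqP ->] := T0 _ ti; rewrite oppr0 mulr0.
have /andP[ti tij] := T1 _ _ nli nlj ij tj.
by rewrite /e (negPf ti) (negPf tj) !mul1r subr_ge0 ler_nat.
Qed.

(** * The block structure of an arbitrary plane *)

Section Stratum.
Variable u : 'M[R]_(2, n).
Hypothesis ufree : row_free u.

Let nl i := (u 0 i != 0) || (u 1 i != 0).
Let dep i j := bracket u i j == 0.

Let depC i j : dep i j = dep j i.
Proof. by rewrite /dep bracketC oppr_eq0. Qed.

Let dep_refl i : dep i i.
Proof. by rewrite /dep /bracket subrr. Qed.

Let dep_trans m i j : nl m -> dep i m -> dep m j -> dep i j.
Proof.
move=> nlm /eqP im /eqP mj; apply/eqP.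
have h (a : 'I_2) : bracket u i j * u a m =
    bracket u m j * u a i + bracket u i m * u a j.
  have : a = 0 \/ a = 1.
    by case: a => [[|[|?]]] // ?; [left|right]; apply: val_inj.
  by rewrite /bracket => -[] ->; ring.
case/orP: nlm => nz; apply: (mulIf nz); by rewrite h im mj !mul0r addr0.
Qed.

Let loop_dep i j : ~~ nl i -> dep i j.
Proof.
rewrite negb_or !negbK /dep /bracket => /andP[/eqP -> /eqP ->].
by rewrite !mul0r mulr0 subrr.
Qed.

(** A nonloop not parallel to the nonloop just before it; [T] thus numbers the maximal runs of
    parallel nonloops. Separated runs receive different numbers even if their columns are parallel,
    which is the loss of information in passing to the envelope. *)
Let change l := nl l && [exists m : 'I_n, [&& (m < l)%N, nl m, ~~ dep m l &
  [forall h : 'I_n, (m < h < l)%N ==> ~~ nl h]]].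

Let T i := #|[set l : 'I_n | (l <= i)%N && change l]|.

Let T_mono i j : (i <= j)%N -> (T i <= T j)%N.
Proof.
move=> ij; apply/subset_leq_card/fintype.subsetP => l; rewrite !inE => /andP[li ->].
by rewrite (leq_trans li ij).
Qed.

Let T_lt i j l : (i < l <= j)%N -> change l -> (T i < T j)%N.
Proof.
move=> /andP[il lj] cl; apply/proper_card/properP; split.
  apply/fintype.subsetP => h; rewrite !inE => /andP[hi ->].
  by rewrite (leq_trans hi) // (leq_trans (ltnW il)).
by exists l; rewrite !inE ?lj ?cl // leqNgt il.
Qed.

Let T_ltP i j : (T i < T j)%N -> exists2 l : 'I_n, (i < l <= j)%N & change l.
Proof.
move=> lt; have [/existsP[l /andP[h1 h2]]|/existsPn no] :=
  boolP [exists l : 'I_n, (i < l <= j)%N && change l]; first by exists l.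
move: lt; rewrite ltnNge => /negP[]; apply/subset_leq_card/fintype.subsetP => l.
rewrite !inE => /andP[lj cl]; rewrite cl andbT leqNgt.
by apply/negP => il; have := no l; rewrite il lj cl.
Qed.

(** No change occurs between equal run numbers, so parallelism is handed on from each nonloop to the
    next. *)
Let same_dep i j : nl i -> nl j -> (i <= j)%N -> T i = T j -> dep i j.
Proof.
move=> nli; have [m] := ubnP j; elim: m j => // m IH j jm nlj.
rewrite leq_eqVlt => /orP[/eqP/val_inj -> //|ij] Tij.
have : ~~ change j.
  by apply/negP => /(T_lt (i := i) (j := j)); rewrite ij leqnn Tij ltnn => /(_ isT).
rewrite /change nlj /= negb_exists => /forallP no.
pose P m := nl m && (m < j)%N.
have Pi : P i by rewrite /P nli.
case: (@arg_maxnP _ i P val Pi) => p /andP[nlp pj] pmax.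
have ip : (i <= p)%N by exact: pmax.
have dip : dep i p.
  apply: IH => //; first by rewrite -ltnS (leq_trans _ jm) // ltnS.
  by apply/eqP; rewrite eqn_leq T_mono // Tij T_mono // ltnW.
apply: (dep_trans nlp dip); have := no p; rewrite pj nlp /=.
case: (dep p j) => //= /forallPn [h]; rewrite negb_imply negbK.
move=> /andP[/andP[ph hj] nlh]; have := pmax h; rewrite /P nlh hj => /(_ isT).
by rewrite /= leqNgt ph.
Qed.

(** The change must happen at [b] itself. The nonloop before [b] belongs to the run of [i], so it is
    parallel to [i] and independent of [b]. *)
Let next_indep i b : nl i -> nl b -> (i < b)%N ->
  (forall l : 'I_n, (i < l < b)%N -> nl l -> T l = T i) -> (T i < T b)%N -> ~~ dep i b.
Proof.
move=> nli nlb ib h /T_ltP [l /andP[il lb] cl].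
have [/eqP elb|nlb'] := boolP (l == b); last first.
  have {}lb : (l < b)%N by rewrite ltn_neqAle nlb' lb.
  have nll : nl l by case/andP: cl.
  have := T_lt (i := i) (j := l) (l := l); rewrite il leqnn => /(_ isT cl).
  by rewrite h ?ltnn // il lb.
rewrite {}elb in cl; case/andP: cl => _ /existsP[m /and4P[mb nlm mdep /forallP no]].
have im : (i <= m)%N.
  rewrite leqNgt; apply/negP => mi; have := no i; rewrite mi ib /=.
  by rewrite nli.
apply: contra mdep => dib.
apply: (dep_trans nli _ dib); rewrite depC; apply: same_dep => //.
move: im; rewrite leq_eqVlt => /orP[/eqP/val_inj -> //|im].
by rewrite h // im mb.
Qed.

(** The classes are the runs, except that a final stretch parallel to the first nonloop is put into
    class 0. A first basis of this block matroid joins two cyclically neighbouring classes, and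
    those are independent in [u]. *)
Lemma exists_block_positroid : exists nl' tl t, [/\ block_data nl' tl t,
  positroids R 2 (block_matroid nl' t), matroid_mx u \subset block_matroid nl' t &
  forall i b, first_partner (block_matroid nl' t) i b -> [set i; b] \in matroid_mx u].
Proof.
have [I0 I0u] := row_free_matroid ufree.
have /andP[/cards2P [x [y [nxy eI0]]] _] : (#|I0| == 2) && (max_minor u I0 != 0).
  by move: I0u; rewrite inE.
have xydep : ~~ dep x y by rewrite /dep -mem_matroid2 -eI0.
have nlx : nl x by apply: contraR xydep => /loop_dep.
have nly : nl y by apply: contraR xydep => /loop_dep; rewrite depC.
case: (@arg_minnP _ x nl val nlx) => i0 nl0 i0min.
(* The tail: nonloops from which on every nonloop is parallel to the first nonloop [i0]. *)
pose tl i := nl i && [forall h : 'I_n, (i <= h)%N && nl h ==> dep i0 h].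
have tlP (i h : 'I_n) : tl i -> (i <= h)%N -> nl h -> dep i0 h.
  by move=> /andP[_ /forallP/(_ h)/implyP hh] ih nlh; apply: hh; rewrite ih.
have tlI (i : 'I_n) : nl i -> (forall h : 'I_n, (i <= h)%N -> nl h -> dep i0 h) -> tl i.
  by move=> nli hh; rewrite /tl nli; apply/forallP => h; apply/implyP => /andP[] /hh.
pose t i : 'I_n.+1 := if tl i then ord0 else inord (T i).
have Tn i : (T i < n.+1)%N by rewrite ltnS -[X in (_ <= X)%N]card_ord max_card.
have tT i : ~~ tl i -> t i = T i :> nat.
  by move=> nt; rewrite /t (negPf nt) inordK.
have tt i : tl i -> t i = ord0 by rewrite /t => ->.
have T1 (i j : 'I_n) : nl i -> nl j -> (i < j)%N -> ~~ tl j -> ~~ tl i && (t i <= t j)%N.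
  move=> nli nlj ij ntj; have nti : ~~ tl i.
    apply: contra ntj => ti; apply: tlI => // h jh nlh.
    by apply: (tlP i) => //; exact: leq_trans (ltnW ij) jh.
  by rewrite nti !tT // T_mono // ltnW.
have D : block_data nl tl t by split=> // i ti; rewrite tt // eqxx andbT; case/andP: ti.
(* Otherwise all nonloops would be parallel, against the rank 2 of [u]. *)
have nt0 : ~~ tl i0.
  apply/negP => t0; have hx := tlP _ _ t0 (i0min _ nlx) nlx.
  have hy := tlP _ _ t0 (i0min _ nly) nly.
  by case/negP: xydep; apply: (dep_trans nl0 _ hy); rewrite depC.
have T0 : T i0 = 0%N.
  apply/eqP; rewrite cards_eq0; apply/eqP/setP => l; rewrite !inE.
  apply/negP => /andP[li0 /andP[_ /existsP[m /and4P[ml nlm _ _]]]].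
  by have := i0min _ nlm; rewrite /= leqNgt (leq_trans ml li0).
have sub (i j : 'I_n) : (i < j)%N -> ~~ dep i j -> [set i; j] \in block_matroid nl t.
  move=> ij ndij; rewrite mem_block_matroid.
  have nli : nl i by apply: contraR ndij => /loop_dep.
  have nlj : nl j by apply: contraR ndij => /loop_dep; rewrite depC.
  rewrite nli nlj /=; apply: contra ndij => /eqP tij.
  have [tj|tj] := boolP (tl j).
    have d0j := tlP _ _ tj (leqnn _) nlj; apply: (dep_trans nl0 _ d0j); rewrite depC.
    have [ti|ti] := boolP (tl i); first exact: tlP ti (leqnn _) nli.
    apply: (same_dep nl0 nli (i0min _ nli)).
    by rewrite T0 -tT // tij tt.
  have /andP[ti _] := T1 _ _ nli nlj ij tj.
  by apply: same_dep; rewrite // 1?ltnW // -!tT // tij.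
have sub' : matroid_mx u \subset block_matroid nl t.
  apply/fintype.subsetP => I Iu; have := Iu; rewrite inE => /andP[/cards2P[i [j [nij eI]]] _].
  rewrite eI mem_matroid2 in Iu *.
  move: nij; rewrite -val_eqE neq_ltn => /orP[lt|lt]; first exact: sub.
  by rewrite finset.setUC; apply: sub => //; move: Iu; rewrite -/(dep i j) depC.
exists nl, tl, t; split => //; first exact: block_positroid D (fintype.subsetP sub' _ I0u).
move=> i b [ib first]; rewrite mem_matroid2 -/(dep i b).
move: ib; rewrite mem_block_matroid => /and3P[nli nlb tib].
have nib : i != b by apply: contraNneq tib => ->.
have {}first l : (0 < cyc_pos i l < cyc_pos i b)%N -> nl l -> t l = t i.
  move=> /first; rewrite mem_block_matroid nli /= => + nll; rewrite nll /= negbK.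
  by move/eqP.
have tail_i : dep i0 i -> (forall h : 'I_n, (i < h)%N -> nl h -> dep i0 h) -> tl i.
  move=> d0 hh; apply: tlI => // h; rewrite leq_eqVlt => /orP[/eqP/val_inj <- //|].
  exact: hh.
have := nib; rewrite -val_eqE neq_ltn => /orP[lt|lt].
  have {}first (l : 'I_n) : (i < l < b)%N -> nl l -> t l = t i.
    by move=> /andP[il lb]; apply: first; exact: cyc_pos_inside.
  have [tb|tb] := boolP (tl b).
    have [ti|ti] := boolP (tl i); first by rewrite (tt i) // (tt b) // eqxx in tib.
    (* If [i] were parallel to [b], it would be parallel to [i0], and so would every later nonloop:
       those before [b] have the class of [i], the others lie in the tail. Then [i] would be in the
       tail. *)
    apply/negP => dib; case/negP: (ti); apply: tail_i => [|h ih nlh].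
      by apply: (dep_trans nlb (tlP _ _ tb (leqnn _) nlb) _); rewrite depC.
    have [bh|hb] := leqP b h; first exact: tlP tb bh nlh.
    have thi : t h = t i by apply: first => //; rewrite ih hb.
    have th : ~~ tl h.
      by apply: contra tib => th; rewrite (tt b) // -thi (tt h).
    have d0i : dep i0 i.
      by apply: (dep_trans nlb (tlP _ _ tb (leqnn _) nlb) _); rewrite depC.
    apply: (dep_trans nli d0i _); apply: same_dep => //; first exact: ltnW.
    by rewrite -!tT // thi.
  have /andP[ti tle] := T1 _ _ nli nlb lt tb.
  apply: next_indep => // [l lib nll|].
    have /andP[il lb] := lib; have /andP[tl' _] := T1 _ _ nll nlb lb tb.
    by rewrite -!tT // first.
  rewrite -!tT // ltn_neqAle tle andbT; exact: tib.
have first1 (l : 'I_n) : (i < l)%N -> nl l -> t l = t i.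
  by move=> il; apply: first; exact: cyc_pos_after.
have first2 (l : 'I_n) : (l < b)%N -> nl l -> t l = t i.
  by move=> lb; apply: first; exact: cyc_pos_before.
(* Here the arc from [i] to [b] wraps around. With [i] in the tail, all nonloops before [b] have
   class 0, so [b] is independent of [i0], to which [i] is parallel. *)
have [ti|ti] := boolP (tl i).
  have tb : ~~ tl b by apply: contra tib => tb; rewrite (tt i) // (tt b).
  have Tb : (0 < T b)%N.
    rewrite -tT // lt0n; apply: contra tib => /eqP tb0; rewrite (tt i) //.
    by apply/eqP/val_inj; rewrite /= tb0.
  have i0b : (i0 < b)%N.
    rewrite ltn_neqAle i0min // andbT; apply/negP => /eqP/val_inj e.
    by rewrite -e T0 in Tb.
  have nd : ~~ dep i0 b.
    apply: next_indep => // [l /andP[il lb] nll|]; last by rewrite T0.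
    have /andP[tl' _] := T1 _ _ nll nlb lb tb.
    by rewrite T0 -tT // first2 // tt.
  apply: contra nd => dib; apply: (dep_trans nli _ dib); exact: tlP ti (leqnn _) nli.
have /andP[tb tle] := T1 _ _ nlb nli lt ti.
have Tbi : (T b < T i)%N by rewrite -!tT // ltn_neqAle tle andbT eq_sym; exact: tib.
(* Were [i0] before [b], it would lie on the arc and have the class of [i]; but its number is 0,
   whereas [T i] exceeds [T b]. *)
have eb : b = i0.
  apply: val_inj; apply/eqP; rewrite eqn_leq i0min // andbT leqNgt; apply/negP => i0b.
  have := first2 _ i0b nl0 => /(congr1 val); rewrite /= !tT // T0 => e.
  by rewrite -e in Tbi.
apply/negP => dib; rewrite eb depC in dib; case/negP: (ti).
apply: tail_i => // h ih nlh; have thi := first1 _ ih nlh.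
apply: (dep_trans nli dib _); apply: same_dep => //; first exact: ltnW.
have th : ~~ tl h.
  apply/negP => /tt; rewrite thi => /(congr1 val) /=; rewrite tT // => Ti0.
  by rewrite Ti0 in Tbi.
by rewrite -!tT // thi.
Qed.

End Stratum.

(** The block positroid of a nonnegative frame contains [N], and its first bases belong to [N];
    hence the two coincide. *)
Lemma positroid_blocks N : positroids R 2 N ->
  exists nl tl t, block_data nl tl t /\ N = block_matroid nl t.
Proof.
move=> pN; have [u [uf _] eN] := (positroid_mxP R N (isT : 0 < 2)%N).1 pN.
have [nl [tl [t [D pB sub first]]]] := exists_block_positroid uf.
exists nl, tl, t; split => //; apply/eqP; rewrite finset.eqEsubset {1}eN sub /=.
apply: (sub_of_first_partners pN) => [I|i b]; first exact: positroid_card pB.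
by rewrite eN; exact: first.
Qed.

Lemma exists_stratum (W : Gr R 2 n) :
  exists2 N, positroids R 2 N & open_positroid_variety N W.
Proof.
have fu := frame_vbasis W.
have [nl [tl [t [D pB sub first]]]] := exists_block_positroid (frame_row_free fu).
by exists (block_matroid nl t) => //; apply/(open_positroidP pB fu).
Qed.

End Blocks.

(** * Duality and compactness *)

Section Duality.
Variables (R : realType) (n : nat).

Lemma row_minor_scale m (A : 'M[R]_(n, m)) (d : 'I_n -> R) s : size s = m ->
  row_minor (\matrix_(i, j) (d i * A i j)) s = (\prod_(i <- s) d i) * row_minor A s.
Proof.
move=> sm; have [x0|s0] : 'I_n + (s = [::]) by case: (s) => [|x s']; [right|left].
  rewrite !(row_minorE _ x0) // (big_nth x0) sm big_mkord.
  transitivity (\det (diag_mx (\row_(i < m) d (nth x0 s i)) *m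
      rowsub (fun i : 'I_m => nth x0 s i) A)); last first.
    by rewrite det_mulmx det_diag; congr (_ * _); apply: eq_bigr => i _; rewrite mxE.
  congr (\det _); apply/matrixP => i j; rewrite !mxE (bigD1 i) //= big1.
    by rewrite !mxE eqxx mulr1n addr0.
  by move=> l li; rewrite !mxE eq_sym (negPf li) mulr0n mul0r.
by rewrite s0 big_nil mul1r.
Qed.

(** A shuffle sign: with indices counted from 0, the element [y] at place m of [s] crosses y - m
    smaller elements of the complement. The total is the sum of [s] minus ['C(size s, 2)], and
    modulo 2 the minus may be a plus. *)
Lemma row_minor_setC (A : 'M[R]_n) (x0 : 'I_n) (s : seq 'I_n) :
  sorted ltn [seq val i | i <- s] ->
  row_minor A (s ++ enum [set x | x \notin s]) =
  (-1) ^+ (\sum_(y <- s) y + 'C(size s, 2))%N * \det A.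
Proof.
elim/last_ind: s => [_|s y IH ss].
  rewrite big_nil mul1r /= (_ : enum _ = enum 'I_n); last first.
    by apply: eq_enum => x; rewrite !inE.
  rewrite (row_minorE _ x0) ?size_enum_ord //; congr (\det _).
  by apply/matrixP => i j; rewrite !mxE nth_ord_enum.
move: (ss); rewrite map_rcons -cats1 (sorted_pairwise ltn_trans) pairwise_cat => /and3P[sy ps _].
rewrite -(sorted_pairwise ltn_trans) in ps.
have {}sy x : x \in s -> (x < y)%N.
  move=> xs; apply: (allrelP sy); first exact: map_f.
  by rewrite mem_seq1.
have us : uniq (rcons s y).
  by rewrite -(map_inj_uniq val_inj) (sorted_uniq ltn_trans ltnn).
set L := [set x | x \notin rcons s y].
have yL : y \notin L by rewrite inE mem_rcons mem_head.
have Ls : y |: L = [set x | x \notin s].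
  apply/setP => x; rewrite !inE mem_rcons in_cons negb_or.
  have [->|//] := eqVneq x y; rewrite /=.
  by move: us; rewrite rcons_uniq => /andP[].
have szL : size (s ++ y :: enum L ++ [::]) = n.
  rewrite cats0 size_cat /= -cardE.
  have := cardsC [set x in rcons s y]; rewrite cardsE (card_uniqP us) card_ord size_rcons.
  rewrite (_ : finset.setC _ = L); last by apply/setP => x; rewrite !inE.
  by move=> e; rewrite -[RHS]e addSnnS.
have := row_minor_insert A szL yL; rewrite !cats0 cat_rcons => ->.
rewrite Ls IH // mulrA -exprD; congr (_ * _).
have c : (#|[set x in L | (x < y)%N]| + size s = y)%N.
  have -> : size s = #|[set x in s]|.
    by move: us; rewrite rcons_uniq cardsE => /andP[_ /card_uniqP ->].
  rewrite -[RHS](card_ord_below (ltnW (ltn_ord y))) 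
    -(cardsID [set x in s] [set l : 'I_n | (l < y)%N]) addnC.
  congr addn; apply: eq_card => x; rewrite !inE ?mem_rcons ?in_cons.
    by rewrite andbC; have [/sy ->|] := boolP (x \in s).
  have [lt|_] := ltnP x y; rewrite ?andbF // !andbT negb_or -val_eqE.
  by rewrite (ltn_eqF lt).
rewrite -signr_odd -[RHS]signr_odd; congr ((-1) ^+ nat_of_bool _).
rewrite -cats1 big_cat big_seq1 size_cat addn1 binS bin1 /=.
have aux (a z v p q : nat) : (a + z = v)%N -> odd (a + (p + q)) = odd (p + v + (q + z)) by lia.
exact: aux c.
Qed.

(** The orthogonal complement with alternating column signs, that is, the kernel of [A']. The twist
    by (-1)^j turns the shuffle signs of complementary minors into the constant [e], and rescaling
    one row by the inverse of [c * e] makes these minors equal, so that nonnegativity is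
    preserved. *)
Lemma exists_dual k r (A : 'M[R]_(k, n)) : n = (k + r)%N -> (0 < r)%N -> row_free A ->
  exists D : 'M[R]_(r, n), forall J : {set 'I_n}, #|J| = r ->
    max_minor D J = max_minor A (finset.setC J).
Proof.
move=> nkr r0 /row_free_max_minor [K0 K0k nz].
have x0 : 'I_n by rewrite nkr; apply: (@Ordinal _ 0); rewrite addn_gt0 r0 orbT.
pose A' : 'M[R]_(k, n) := \matrix_(i, j) ((-1) ^+ j * A i j).
have A'E (K : {set 'I_n}) : #|K| = k ->
    row_minor A'^T (enum K) = (-1) ^+ (\sum_(y in K) y)%N * max_minor A K.
  move=> Kk; rewrite -prodrXr /max_minor -big_enum -row_minor_scale -?cardE //.
  by congr row_minor; apply/matrixP => i j; rewrite !mxE.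
have cE (J : {set 'I_n}) : #|J| = r -> #|finset.setC J| = k.
  by move=> Jr; rewrite cardsCs finset.setCK card_ord Jr nkr addnK.
pose e : R := (-1) ^+ 'C(k, 2).
have sumE (J : {set 'I_n}) : #|J| = r -> \sum_(K : {set 'I_n} | #|K| == k)
    row_minor A'^T (enum K) * row_minor (1%:M : 'M[R]_n) (enum K ++ enum J) =
    e * max_minor A (finset.setC J).
  move=> Jr; rewrite (bigD1 (finset.setC J)) ?cE //= big1 ?addr0.
    rewrite A'E ?cE //.
    have := row_minor_setC 1%:M x0 (enum_set_sorted (finset.setC J)).
    rewrite (_ : [set x | _] = J); last by apply/setP => x; rewrite !inE mem_enum inE negbK.
    rewrite -cardE cE // => ->; rewrite det1 mulr1 exprD -/e big_enum /=.
    rewrite mulrAC mulrA -exprD addnn -signr_odd odd_double mul1r.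
    by rewrite mulrC.
  move=> K /andP[/eqP Kk KJ]; rewrite [X in _ * X]row_minor_notuniq ?mulr0 //.
    by rewrite size_cat -!cardE Kk Jr nkr.
  rewrite cat_uniq !enum_uniq /= andbT negbK; apply: contraNT KJ => /hasPn no.
  rewrite eqEcard Kk cE // leqnn andbT; apply/fintype.subsetP => x xK.
  rewrite inE; apply/negP => xJ; have := no x; rewrite mem_enum => /(_ xJ).
  by rewrite /= mem_enum xK.
have J0r : #|finset.setC K0| = r by rewrite cardsCs finset.setCK card_ord K0k nkr addKn.
have e0 : e != 0 by rewrite signr_eq0.
have nz0 : \sum_(K : {set 'I_n} | #|K| == k) row_minor A'^T (enum K) *
    row_minor (1%:M : 'M[R]_n) (enum K ++ enum (finset.setC K0)) != 0.
  by rewrite sumE // finset.setCK mulf_neq0.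
have sJ0 : size (enum (finset.setC K0)) = r by rewrite -cardE.
have [Y [c c0 h]] := kernel_minors x0 nkr sJ0 nz0.
have [D [g _ [_ DE]]] := scale_row_minors (1%:M *m Y)^T (c * e)^-1 r0.
exists D => J Jr; rewrite DE // /max_minor trmxK h -?cardE // sumE //.
by rewrite [X in _ * X]mulrA mulKf // mulf_neq0.
Qed.

End Duality.

(** * Limits of points of the amplituhedron *)

Section Compactness.
Import numFieldNormedType.Exports.
Local Open Scope classical_set_scope.
Variables (R : realType) (n k : nat) (Z : 'M[R]_(n, k.+2)).

(** The columns of the largest maximal minor are made the identity. By Cramer's rule every entry is
    then, up to sign, another maximal minor or zero, and these are at most 1 by the choice of
    [K0]. *)
Lemma normalize_tnn (A : 'M[R]_(k, n)) : (0 < k)%N -> row_free A -> tnn_matrix A ->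
  exists2 g : 'M[R]_k, \det g != 0 &
    [/\ tnn_matrix (g *m A), forall i j, `|(g *m A) i j| <= 1 &
        exists2 K : {set 'I_n}, #|K| = k & max_minor (g *m A) K = 1].
Proof.
move=> k0 /row_free_max_minor [K1 /eqP K1k nz1] tA.
case: (@arg_maxP _ _ _ K1 (fun K : {set 'I_n} => #|K| == k) (fun K => max_minor A K) K1k)
  => K0 /eqP K0k Kmax.
have K0pos : 0 < max_minor A K0.
  by rewrite (lt_le_trans _ (Kmax _ K1k)) // lt_neqAle eq_sym nz1 tA //; exact/eqP.
have K0n0 : max_minor A K0 != 0 by rewrite gt_eqF.
have sK0 : size (enum K0) = k by rewrite -cardE.
have [x0 _] : exists x0, x0 \in K0 by apply/set0Pn; rewrite -card_gt0 K0k.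
pose B := (rowsub (fun i : 'I_k => nth x0 (enum K0) i) A^T)^T.
have BE : \det B = max_minor A K0 by rewrite det_tr /max_minor (row_minorE _ x0).
have BU : B \in unitmx by rewrite unitmxE unitfE BE.
exists (invmx B); first by rewrite det_inv BE invr_neq0.
have gE (K : {set 'I_n}) : #|K| = k ->
    max_minor (invmx B *m A) K = max_minor A K / max_minor A K0.
  by move=> Kk; rewrite max_minor_mull // det_inv BE mulrC.
set A' := invmx B *m A in gE *.
have A't : tnn_matrix A'.
  by move=> K Kk; rewrite gE // divr_ge0 ?tA // ltW.
have A'1 (K : {set 'I_n}) : #|K| = k -> `|max_minor A' K| <= 1.
  move=> Kk; rewrite ger0_norm ?A't // gE // ler_pdivrMr // mul1r.
  by apply: Kmax; exact/eqP.
have A'K0 : max_minor A' K0 = 1 by rewrite gE // divff.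
split=> //; last by exists K0.
move=> a x; have := row_minor_cramer A' x a sK0.
rewrite -/(max_minor A' K0) A'K0 mul1r => ->.
have idE (i : 'I_k) : A' a (nth x (enum K0) i) = (a == i)%:R.
  have : colsub (fun i : 'I_k => nth x0 (enum K0) i) A' = 1%:M.
    rewrite -mulmx_colsub (_ : colsub _ A = B) ?mulVmx //.
    by apply/matrixP => p q; rewrite !mxE.
  move=> /matrixP/(_ a i); rewrite mxE [in X in _ -> X](set_nth_default x0) ?sK0 // => ->.
  by rewrite mxE.
rewrite (bigD1 a) //= big1 ?addr0; last first.
  by move=> i ia; rewrite idE eq_sym (negPf ia) mulr0.
rewrite idE eqxx mulr1.
have szs : size (set_nth x (enum K0) a x) = k.
  by rewrite size_set_nth sK0; apply/maxn_idPr.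
rewrite row_minor_absE //; case: (boolP (uniq _)) => us; last by rewrite mul0r ler01.
by rewrite mul1r A'1 // cardsE (card_uniqP us).
Qed.

Lemma twistor_mx_mull (g : 'M[R]_k) A u : \det g != 0 ->
  twistor_mx Z A u -> twistor_mx Z (g *m A) u.
Proof.
move=> g0 [c c0 h]; exists (c / \det g) => [|I I2]; first by rewrite mulf_neq0 ?invr_neq0.
rewrite h // (_ : twistor_sum Z (max_minor (g *m A)) I =
  \det g * twistor_sum Z (max_minor A) I); first by rewrite mulrA divfK.
by rewrite mulr_sumr; apply: eq_bigr => K /eqP Kk; rewrite max_minor_mull // mulrA.
Qed.

(** A coordinate that is nonzero at [u] is nonzero at all nearby frames, among them frames of points
    of [S]. *)
Lemma closed_matroid_sub (S : set (Gr R 2 n)) (N : {set {set 'I_n}}) u W :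
  (forall W' u', frame u' W' -> S W' -> matroid_mx u' \subset N) ->
  frame u W -> closure S W -> matroid_mx u \subset N.
Proof.
move=> SN fu clW; apply/fintype.subsetP => I Iu; have /andP[/eqP I2 nz] :
  (#|I| == 2) && (max_minor u I != 0) by move: Iu; rewrite inE.
have cvgI : max_minor v I @[v --> u] --> max_minor u I.
  apply: (@cvg_row_minor R _ (nbhs u) _ n 2 (fun v => v^T) u^T) => i j; rewrite mxE.
  under eq_fun do rewrite mxE.
  exact: coord_continuous.
have : nbhs u [set v | max_minor v I != 0] 
  by apply: (cvgI [set y | y != 0]); apply: open_nbhs_nbhs; split; [exact: open_neq | exact: nz].
rewrite nbhsE => -[O [oO Ou] OI].
have [u' [W' [Ou' SW' fu']]] := closure_frame fu clW oO Ou.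
apply: (fintype.subsetP (SN _ _ fu' SW')).
by rewrite inE I2 eqxx; exact: OI.
Qed.

Hypothesis Zpos : forall J : {set 'I_n}, #|J| = k.+2 -> 0 < row_minor Z (enum J).
Hypotheses (k0 : (0 < k)%N) (kn : (k + 2 <= n)%N).

(* Frames normalized by [normalize_tnn] range over a compact box, and the
   relation [twistor_mx] is closed once written as proportionality of vectors
   of Plücker coordinates. *)
Lemma closure_amplituhedron (S : set (Gr R 2 n)) W :
  S `<=` amplituhedron Z -> closure S W -> amplituhedron Z W.
Proof.
move=> SA clW; have fu := frame_vbasis W; set u := \matrix_(i < 2) _ in fu.
(* Closed conditions only: full rank is replaced by the lower bound 1 on a sum of nonnegative
   minors, and proportionality by cross products, which contain no scalar. *)
pose good (u' : 'M[R]_(2, n)) (v : 'rV[R]_(k * n)) :=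
  [/\ tnn_matrix (vec_mx v : 'M[R]_(k, n)),
      1 <= \sum_(K : {set 'I_n} | #|K| == k) max_minor (vec_mx v : 'M[R]_(k, n)) K &
      forall I J : {set 'I_n}, #|I| = 2 -> #|J| = 2 ->
        max_minor u' I * twistor_sum Z (max_minor (vec_mx v)) J =
        max_minor u' J * twistor_sum Z (max_minor (vec_mx v)) I].
pose box := [set v : 'rV[R]_(k * n) | forall i, `[(-1 : R), 1]%classic (v ord0 i)].
have cbox : compact box.
  exact: (@rV_compact R (k * n) (fun=> `[(-1 : R), 1]%classic) (fun=> @segment_compact R _ _)).
pose B (O : set 'M[R]_(2, n)) := [set v | box v /\ exists2 u', O u' & good u' v].
have Bne O : nbhs u O -> B O !=set0.
  rewrite nbhsE => -[O' [oO' O'u] O'O].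
  have [u' [W' [Ou' SW' fu']]] := closure_frame fu clW oO' O'u.
  have [A [Af At Au]] := (amplituhedronP Z k0 fu').1 (SA _ SW').
  have [g g0 [tgA gA1 [K Kk gAK]]] := normalize_tnn k0 Af At.
  exists (mxvec (g *m A)); split=> [i|].
    rewrite /= in_itv /= -ler_norml; have [a [b ->]] : exists a b, i = mxvec_index a b.
      by case/mxvec_indexP: i => a b; exists a, b.
    by rewrite mxvecE.
  exists u'; first exact: O'O.
  rewrite /good mxvecK; split=> //.
    rewrite (bigD1 K) ?Kk //= gAK lerDl sumr_ge0 // => K' /andP[/eqP K'k _].
    exact: tgA.
  move=> I J I2 J2; have [c c0 h] := twistor_mx_mull g0 Au.
  by rewrite !h //; ring.
pose F := filter_from (nbhs u) B.
have FF : ProperFilter F.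
  apply: filter_from_proper => //; apply: filter_from_filter.
    by exists setT; exact: filterT.
  move=> O O' nO nO'; exists (O `&` O'); first exact: filterI.
  by move=> v [bv [u' [? ?] gu]]; split; split => //; exists u'.
have [|v [bv clv]] := cbox F FF.
  by exists setT; [exact: filterT | move=> v []].
(* Since [v] is a cluster point of vectors that are good for frames tending to [u], every
   neighbourhood of (u, v) contains good pairs, and weak inequalities pass to (u, v). *)
have lim_ge0 (h : 'M[R]_(2, n) * 'rV[R]_(k * n) -> R) (l : R) :
    h z @[z --> filter_prod (nbhs u) (nbhs v)] --> l ->
    (forall u' v', good u' v' -> 0 <= h (u', v')) -> 0 <= l.
  move=> hl h0; rewrite leNgt; apply/negP => l0.
  have : nbhs l [set y | y < 0] by exact: lt_nbhsl.
  move=> /hl[[O Q] /= [nO nQ] OQ].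
  have [v' [[_ [u' Ou' gu']] Qv']] := clv (B O) Q (ex_intro2 _ _ O nO (fun=> id)) nQ.
  by have := OQ (u', v') (conj Ou' Qv'); rewrite /= ltNge h0.
have cvgu I : max_minor z.1 I @[z --> filter_prod (nbhs u) (nbhs v)] --> max_minor u I.
  apply: cvg_row_minor => i j; rewrite mxE; under eq_fun do rewrite mxE.
  exact: (cvg_comp fst (fun M : 'M[R]_(2, n) => M j i) cvg_fst (@coord_continuous R 2 n j i u)).
have cvgA K : max_minor (vec_mx z.2 : 'M[R]_(k, n)) K
    @[z --> filter_prod (nbhs u) (nbhs v)] --> max_minor (vec_mx v : 'M[R]_(k, n)) K.
  apply: cvg_row_minor => i j; rewrite !mxE; under eq_fun do rewrite !mxE.
  exact: (cvg_comp snd (fun M : 'rV[R]_(k * n) => M ord0 (mxvec_index j i)) cvg_snd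
            (@coord_continuous R 1 (k * n) ord0 (mxvec_index j i) v)).
have cvgt I : twistor_sum Z (max_minor (vec_mx z.2 : 'M[R]_(k, n))) I
    @[z --> filter_prod (nbhs u) (nbhs v)] --> twistor_sum Z (max_minor (vec_mx v)) I.
  by apply: cvg_bigsum => K; apply: cvgM; [exact: cvgA | exact: cvg_cst].
have tv : tnn_matrix (vec_mx v : 'M[R]_(k, n)).
  by move=> K Kk; apply: lim_ge0 (cvgA K) _ => u' v' [/(_ K Kk)].
have sum1 : 1 <= \sum_(K : {set 'I_n} | #|K| == k) max_minor (vec_mx v : 'M[R]_(k, n)) K.
  rewrite -subr_ge0; apply: lim_ge0.
    by apply: cvgB; [apply: cvg_bigsum => K; exact: cvgA | exact: cvg_cst].
  by move=> u' v' [_ + _]; rewrite -subr_ge0.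
have cross (I J : {set 'I_n}) : #|I| = 2 -> #|J| = 2 ->
    max_minor u I * twistor_sum Z (max_minor (vec_mx v)) J =
    max_minor u J * twistor_sum Z (max_minor (vec_mx v)) I.
  move=> I2 J2; apply/eqP; rewrite -subr_eq0 eq_le -[X in X && _]oppr_ge0.
  pose h (z : 'M[R]_(2, n) * 'rV[R]_(k * n)) :=
    max_minor z.1 I * twistor_sum Z (max_minor (vec_mx z.2)) J -
    max_minor z.1 J * twistor_sum Z (max_minor (vec_mx z.2)) I.
  have hl : h z @[z --> filter_prod (nbhs u) (nbhs v)] --> h (u, v).
    by apply: cvgB; apply: cvgM; [exact: cvgu|exact: cvgt|exact: cvgu|exact: cvgt].
  have h0 u' v' : good u' v' -> h (u', v') = 0.
    by move=> [_ _ hc]; rewrite /h /= (hc I J) // subrr.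
  apply/andP; split.
    by apply: lim_ge0 (cvgN hl) _ => u' v' /h0 e; rewrite /= e oppr0.
  by apply: lim_ge0 hl _ => u' v' /h0 ->.
have fv : row_free (vec_mx v : 'M[R]_(k, n)).
  apply/row_free_max_minor.
  have [/existsP[K /andP[/eqP Kk nz]]|/existsPn no] := boolP
    [exists K : {set 'I_n}, (#|K| == k) && (max_minor (vec_mx v : 'M[R]_(k, n)) K != 0)].
    by exists K.
  move: sum1; rewrite big1 ?ler10 // => K Kk; have := no K.
  by rewrite Kk negbK => /eqP.
apply/(amplituhedronP Z k0 fu); exists (vec_mx v); split => //.
have [J J2 Jnz] := tnn_twistor_neq0 Zpos k0 kn fv tv.
have [I0 I02 I0nz] := (row_free_max_minor u).1 (frame_row_free fu).
(* The scalar is recovered at a [J] where the twistor coordinate of the limit does not vanish. It is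
   nonzero itself, for otherwise the cross products would kill every minor of [u]. *)
exists (max_minor u J / twistor_sum Z (max_minor (vec_mx v)) J).
  rewrite mulf_neq0 ?invr_neq0 //; apply: contraNneq I0nz => J0.
  by have := cross _ _ I02 J2; rewrite J0 mul0r => /eqP; rewrite mulf_eq0 (negPf Jnz) orbF.
by move=> I I2; rewrite mulrAC -cross // mulfK.
Qed.

End Compactness.

(** * Deformation within a block structure *)

Section Rearrangement.
Local Open Scope nat_scope.
Variables (r : nat) (f g : 'I_r -> nat).
Hypothesis f_incr : forall i j : 'I_r, i < j -> f i < f j.
Hypothesis g_incr : forall i j : 'I_r, i < j -> g i < g j.

Let S (s : {perm 'I_r}) := \sum_i f i * g (s i).

(** With [i] the first moved index and [s j = i], both [i < j] and [i < s i] hold. Exchanging the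
    two values adds (f j - f i) (g (s i) - g i), which is positive. *)
Lemma rearrangement_step (s : {perm 'I_r}) : s != 1%g -> exists s', S s < S s'.
Proof.
move=> s1; have [i0 si0] : exists i, s i != i.
  apply/existsP; apply: contraR s1; rewrite negb_exists => /forallP h.
  by apply/eqP/permP => i; rewrite perm1; have := h i; rewrite negbK => /eqP.
case: (@arg_minnP _ i0 (fun i => s i != i) val si0) => i si imin.
pose j := (s^-1)%g i; have sj : s j = i by rewrite permKV.
have fix_lt (x : 'I_r) : x < i -> s x = x.
  by move=> xi; apply/eqP; apply: contraTT xi => /imin; rewrite -leqNgt.
have isi : i < s i.
  rewrite ltn_neqAle [_ == _]eq_sym si leqNgt; apply/negP => /fix_lt.
  by move/perm_inj => e; rewrite e eqxx in si.
have ij : i < j.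
  rewrite ltn_neqAle; apply/andP; split.
    by apply: contraNneq si => /val_inj {1}->; rewrite sj.
  by rewrite leqNgt; apply/negP => ji; have := fix_lt _ ji; rewrite sj => e; rewrite e ltnn in ji.
have nji : j != i by rewrite -val_eqE /= neq_ltn ij orbT.
exists (tperm i j * s)%g; rewrite /S.
rewrite (bigD1 i) // (bigD1 j) //= [X in _ < X](bigD1 i) // [X in _ < _ + X](bigD1 j) //=.
rewrite !permM tpermL tpermR sj.
rewrite [X in _ < _ + (_ + X)](eq_bigr (fun x => f x * g (s x))); last first.
  by move=> x /andP[xi xj]; rewrite permM tpermD // eq_sym.
rewrite !addnA ltn_add2r; have := f_incr ij; have := g_incr isi.
by nia.
Qed.

Lemma rearrangement (s : {perm 'I_r}) : s != 1%g -> S s < S 1%g.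
Proof.
move=> s1; case: (@arg_maxnP _ s predT S isT) => m _ mmax.
have [m1|/rearrangement_step [m' lt]] := eqVneq m 1%g.
  have [s' lt] := rearrangement_step s1; apply: leq_trans lt _.
  by rewrite -m1; exact: mmax.
by have := leq_trans lt (mmax m' isT); rewrite ltnn.
Qed.

End Rearrangement.

(** * A totally positive kernel tending to the identity *)

Section GaussianKernel.
Variable R : realType.

(** One of the two truncated differences is 0, so this is the squared distance in [nat]. *)
Definition sqdist (a b : nat) := ((a - b + (b - a)) ^ 2)%N.

(** Only the cross term is affected by permuting the [b]'s: a smallest total exponent means a
    largest sum of products, which is the subject of the rearrangement inequality. *)
Lemma sqdistE a b : (sqdist a b + 2 * (a * b) = a ^ 2 + b ^ 2)%N.
Proof.
rewrite /sqdist; have [c [->|->]] : exists c, b = (c + a)%N \/ a = (c + b)%N.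
- by exists ((a - b) + (b - a))%N; lia.
- have -> : (a - (c + a) + (c + a - a) = c)%N by lia.
  by rewrite -!mulnn; nia.
- have -> : (c + b - b + (b - (c + b)) = c)%N by lia.
  by rewrite -!mulnn; nia.
Qed.

Definition gauss m (q : R) : 'M[R]_m := \matrix_(i, j) q ^+ sqdist i j.

(* For small [q] the identity permutation dominates the expansion, by the
   rearrangement inequality. *)
Lemma gauss_det_gt0 r (f g : 'I_r -> nat) (q : R) :
  (forall i j : 'I_r, (i < j)%N -> (f i < f j)%N) ->
  (forall i j : 'I_r, (i < j)%N -> (g i < g j)%N) ->
  0 < q -> q * (r`!)%:R < 1 ->
  0 < \det (\matrix_(i < r, j < r) q ^+ sqdist (f i) (g j)).
Proof.
move=> fi gi q0 qr; pose E (s : {perm 'I_r}) := (\sum_i sqdist (f i) (g (s i)))%N.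
have q1 : q <= 1.
  apply: le_trans (ltW qr); rewrite -[leLHS]mulr1 ler_pM2l //.
  by rewrite ler1n fact_gt0.
have Elt s : s != 1%g -> (E 1%g < E s)%N.
  move=> /(rearrangement fi gi) lt.
  have e (s' : {perm 'I_r}) : (E s' + 2 * \sum_i f i * g (s' i) =
      \sum_i f i ^ 2 + \sum_i g i ^ 2)%N.
    rewrite big_distrr /= -big_split /=.
    under eq_bigr do rewrite sqdistE.
    rewrite big_split /=; congr addn.
    by rewrite [RHS](reindex_inj (@perm_inj _ s')).
  by have := e s; have := e 1%g; lia.
have dE : \det (\matrix_(i < r, j < r) q ^+ sqdist (f i) (g j)) =
    \sum_(s : {perm 'I_r}) (-1) ^+ s * q ^+ E s.
  apply: eq_bigr => s _; congr (_ * _); rewrite /E -prodrXr.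
  by apply: eq_bigr => i _; rewrite mxE.
rewrite dE (bigD1 1%g) //= odd_perm1 mul1r.
(* Exponents are integers, so every other permutation contributes at least one more factor [q]; this
   is why [q * r!] below 1 suffices. *)
have bound : `|\sum_(s : {perm 'I_r} | s != 1%g) (-1) ^+ s * q ^+ E s| <=
    (r`!)%:R * q ^+ (E 1%g).+1.
  apply: le_trans (ler_norm_sum _ _ _) _.
  apply: (@le_trans _ _ (\sum_(s : {perm 'I_r}) q ^+ (E 1%g).+1)).
    rewrite big_mkcond /=; apply: ler_sum => s _; case: ifP => [s1|_]; last first.
      by rewrite exprn_ge0 // ltW.
    rewrite normrM normrX normrN1 expr1n mul1r ger0_norm ?exprn_ge0 ?(ltW q0) //.
    by rewrite ler_wiXn2l ?(ltW q0) // Elt.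
  by rewrite sumr_const card_Sn mulr_natl.
move: bound; rewrite ler_norml => /andP[b _].
have : 0 < q ^+ E 1%g * (1 - q * r`!%:R) by rewrite mulr_gt0 ?exprn_gt0 // subr_gt0.
rewrite exprS in b; move: b.
set x := q ^+ _; set y := \sum_(_ | _) _; set z := r`!%:R => b h.
have -> : x + y = x * (1 - q * z) + (z * (q * x) + y) by ring.
by rewrite ltr_wpDr // -lerBlDl sub0r.
Qed.

(** One dummy unit row and column bring the square case into the shape of the formula with extra
    rows. *)
Lemma det_mul_minors n k (C : 'M[R]_(k, n)) (Z : 'M[R]_(n, k)) (x0 : 'I_n) :
  \det (C *m Z) = \sum_(K : {set 'I_n} | #|K| == k)
    row_minor C^T (enum K) * row_minor Z (enum K).
Proof.
pose T : 'M[R]_(1, k + 1) := row_mx 0 1%:M.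
have blk (X : 'M[R]_k) : \det (col_mx (row_mx X 0) T) = \det X.
  by rewrite -[col_mx _ _]/(block_mx X 0 0 1%:M) det_lblock det1 mulr1.
rewrite -blk (_ : row_mx (C *m Z) 0 = C *m row_mx Z 0); last by rewrite mul_mx_row mulmx0.
rewrite (det_col_mx_mul _ _ _ x0).
apply: eq_bigr => K /eqP Kk; congr (_ * _).
rewrite (row_minorE _ x0) -?cardE // -blk; congr (\det (col_mx _ _)).
apply/matrixP => i j; rewrite mxE -[j]splitK; case: (fintype.split j) => l /=.
  by rewrite !row_mxEl mxE.
by rewrite !row_mxEr !mxE.
Qed.

(** In the Cauchy-Binet sum all minors of the kernel are positive, those of [U] are nonnegative, and
    at least one of the latter is nonzero. *)
Lemma gauss_smoothing r m (U : 'M[R]_(r, m)) (q : R) (B : {set 'I_m}) :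
  (0 < r)%N -> tnn_matrix U -> row_free U -> 0 < q -> q * (r`!)%:R < 1 -> #|B| = r ->
  0 < max_minor (U *m gauss m q) B.
Proof.
move=> r0 tU /row_free_max_minor [K Kr nz] q0 qr Br.
have [x0 _] : exists x0, x0 \in K by apply/set0Pn; rewrite -card_gt0 Kr.
have sorted_nth (J : {set 'I_m}) : #|J| = r -> forall i j : 'I_r, (i < j)%N ->
    (nth x0 (enum J) i < nth x0 (enum J) j)%N.
  move=> Jr i j ij; have sJ : size (enum J) = r by rewrite -cardE.
  have := sorted_ltn_nth ltn_trans 0%N (enum_set_sorted J) i j.
  rewrite !inE size_map sJ !ltn_ord => /(_ isT isT ij).
  by rewrite !(nth_map x0) ?sJ.
pose G := colsub (fun i : 'I_r => nth x0 (enum B) i) (gauss m q).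
have -> : max_minor (U *m gauss m q) B = \det (U *m G).
  rewrite /max_minor (row_minorE _ x0) -?cardE // -det_tr; congr (\det _).
  by rewrite mulmx_colsub; apply/matrixP => i j; rewrite !mxE.
have Gpos (J : {set 'I_m}) : #|J| = r -> 0 < row_minor G (enum J).
  move=> Jr; rewrite (row_minorE _ x0) -?cardE //.
  have := gauss_det_gt0 (sorted_nth J Jr) (sorted_nth B Br) q0 qr.
  congr (0 < _); congr (\det _); apply/matrixP => i j; by rewrite !mxE.
rewrite (det_mul_minors _ _ x0) (bigD1 K) ?Kr //=.
rewrite ltr_pwDl //.
  by rewrite mulr_gt0 ?Gpos // lt_neqAle eq_sym nz tU.
apply: sumr_ge0 => J /andP[/eqP Jr _]; apply: mulr_ge0; first exact: tU.
by rewrite ltW // Gpos.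
Qed.

End GaussianKernel.

(** * Minors adapted to classes and their wrap-around *)

Section RowMinorBlocks.
Variable R : realType.

Lemma eq_in_row_minor n m (A A' : 'M[R]_(n, m)) s :
  (forall i j, i \in s -> A i j = A' i j) -> row_minor A s = row_minor A' s.
Proof.
move=> e; congr (\det _); apply/matrixP => i j; rewrite !mxE; congr (_`_i).
by apply/eq_in_map => x xs; exact: e.
Qed.

Lemma row_minor_block n m r (M : 'M[R]_(r, n)) (Y : 'M[R]_(r, m)) (t : 'I_n -> 'I_m)
    (d : 'I_n -> R) s : size s = r ->
  (forall a i, i \in s -> M a i = d i * Y a (t i)) ->
  row_minor M^T s = (\prod_(i <- s) d i) * row_minor Y^T [seq t i | i <- s].
Proof.
move=> sr e.
transitivity (row_minor (\matrix_(i, j) (d i * (rowsub t Y^T) i j)) s).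
  by apply: eq_in_row_minor => i j si; rewrite !mxE e.
rewrite row_minor_scale //; congr (_ * \det _); apply/matrixP => i j; rewrite !mxE.
by rewrite -map_comp; congr (_`_i); apply: eq_map => x /=; rewrite mxE.
Qed.

(** If no exchange of [i] into a fixed basis gave a basis, Cramer's rule would make the entry
    [D a i] vanish. *)
Lemma basis_through n r (D : 'M[R]_(r, n)) i a : row_free D -> D a i != 0 ->
  exists J : {set 'I_n}, [/\ #|J| = r, i \in J & max_minor D J != 0].
Proof.
move=> /row_free_max_minor [J0 J0r nz] Dai.
have sJ0 : size (enum J0) = r by rewrite -cardE.
have cr := row_minor_cramer D i a sJ0.
have [/existsP[l nzl]|/existsPn no] :=
    boolP [exists l : 'I_r, row_minor D^T (set_nth i (enum J0) l i) != 0].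
  have szs : size (set_nth i (enum J0) l i) = r.
    by rewrite size_set_nth sJ0; apply/maxn_idPr.
  move: nzl; rewrite -normr_eq0 row_minor_absE // mulf_eq0 negb_or pnatr_eq0 eqb0 negbK.
  rewrite normr_eq0 => /andP[us nzl]; exists [set x in set_nth i (enum J0) l i].
  split => //; first by rewrite cardsE (card_uniqP us).
  rewrite inE; apply/(nthP i); exists (val l); first by rewrite szs; exact: ltn_ord.
  by rewrite nth_set_nth /= eqxx.
move: cr => /eqP; rewrite big1 ?mulf_eq0 ?(negPf Dai) ?orbF -/(max_minor D J0) ?(negPf nz) //.
by move=> l _; have := no l; rewrite negbK => /eqP ->; rewrite mul0r.
Qed.

Variables (n r : nat) (nl tl : pred 'I_n) (t : 'I_n -> 'I_n.+1).
Hypothesis D01 : block_data nl tl t.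
Hypothesis r_gt0 : (0 < r)%N.

Definition tail_sign i : R := if tl i then (-1) ^+ r.-1 else 1.

Lemma tail_signK i : tail_sign i * tail_sign i = 1.
Proof.
rewrite /tail_sign; case: (tl i); last exact: mulr1.
by rewrite -exprMn mulrNN mulr1 expr1n.
Qed.

Definition tail_twist (M : 'M[R]_(r, n)) : 'M[R]_(r, n) :=
  \matrix_(a, i) (tail_sign i * M a i).

(* Ordering the columns by class moves at most one tail column, the only one of
   class [0], across the [r - 1] others. *)
Lemma tail_twist_minor (M : 'M[R]_(r, n)) (s : seq 'I_n) : size s = r ->
  (forall i, i \in s -> nl i) -> sorted ltn [seq val (t i) | i <- s] ->
  row_minor (tail_twist M)^T s = max_minor M [set x in s].
Proof.
have [T0 T1] := D01.
have -> : (tail_twist M)^T = \matrix_(i, j) (tail_sign i * M^T i j).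
  by apply/matrixP => i j; rewrite !mxE.
move=> sr snl; rewrite row_minor_scale //.
case: s sr snl => [|x s] sr snl /=; first by have := r_gt0; rewrite -[X in (0 < X)%N]sr.
rewrite path_sortedE; last exact: ltn_trans.
move=> /andP[/allP xs ss].
have xlt y : y \in s -> (t x < t y)%N by move=> ys; apply: xs; apply: map_f.
have ntl y : y \in s -> ~~ tl y.
  move=> ys; apply/negP => /T0 /andP[_ /eqP ty].
  by have := xlt y ys; rewrite ty.
have snl' y : y \in s -> nl y by move=> ys; apply: snl; rewrite in_cons ys orbT.
have nlx : nl x by apply: snl; rewrite mem_head.
have lt_of y z : nl y -> nl z -> ~~ tl y -> (t y < t z)%N -> (y < z)%N.
  move=> nly nlz nty tyz; rewrite ltnNge; apply/negP; rewrite leq_eqVlt.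
  case/orP=> [/eqP/val_inj e|zy]; first by rewrite e ltnn in tyz.
  by have /andP[_] := T1 _ _ nlz nly zy nty; rewrite leqNgt tyz.
have sval : sorted ltn [seq val i | i <- s].
  move: ss; rewrite !sorted_map; apply: (@sub_in_sorted _ (mem s)); last exact/allP.
  by move=> y z ys zs; apply: lt_of; [exact: snl'|exact: snl'|exact: ntl].
have eps1 : \prod_(i <- s) tail_sign i = 1.
  by rewrite big_seq big1 // => i /ntl; rewrite /tail_sign => /negPf ->.
rewrite big_cons eps1 mulr1 /max_minor /tail_sign.
have [tx|tx] := boolP (tl x); last first.
  rewrite mul1r; congr row_minor; apply: enum_set_eq => [|y]; last by rewrite [RHS]inE.
  rewrite /= path_sortedE ?sval ?andbT; last exact: ltn_trans.
  by apply/allP => _ /mapP[y ys ->]; exact: lt_of nlx (snl' _ ys) tx (xlt _ ys).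
have mv := @row_minor_move R n r M^T [::] s [::] x.
rewrite /= cats0 in mv; rewrite mv //.
rewrite mulrA -[size s]/((size s).+1.-1) -[(size s).+1]/(size (x :: s)) sr.
rewrite -exprMn mulrNN mulr1 expr1n mul1r; congr row_minor.
apply: enum_set_eq => [|y]; last by rewrite [RHS]inE mem_cat mem_seq1 in_cons orbC.
rewrite map_cat (sorted_pairwise ltn_trans) pairwise_cat -!(sorted_pairwise ltn_trans).
rewrite sval /= !andbT; apply/allrelP => p q /mapP[y ys ->]; rewrite mem_seq1 => /eqP ->.
rewrite ltnNge; apply/negP; rewrite leq_eqVlt => /orP[/eqP/val_inj e|xy].
  by have := ntl y ys; rewrite -e tx.
by have /andP[] := T1 _ _ nlx (snl' _ ys) xy (ntl _ ys); rewrite tx.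
Qed.

Definition class_sort (J : {set 'I_n}) := sort (fun i j => (t i <= t j)%N) (enum J).

Lemma class_sort_sorted (J : {set 'I_n}) : transversal nl t J ->
  sorted ltn [seq val (t i) | i <- class_sort J].
Proof.
move=> /transversalP [_ inj]; rewrite ltn_sorted_uniq_leq; apply/andP; split.
  rewrite map_inj_in_uniq ?sort_uniq ?enum_uniq // => i j.
  by rewrite !mem_sort !mem_enum => iJ jJ /val_inj; exact: inj.
rewrite sorted_map; apply: sort_sorted => i j; exact: leq_total.
Qed.

Lemma class_sort_minor (M : 'M[R]_(r, n)) (J : {set 'I_n}) : #|J| = r -> transversal nl t J ->
  max_minor M J = row_minor (tail_twist M)^T (class_sort J).
Proof.
move=> Jr tJ; rewrite tail_twist_minor.
- by congr max_minor; apply/setP => x; rewrite inE mem_sort mem_enum.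
- by rewrite size_sort -cardE.
- by move=> i; rewrite mem_sort mem_enum; have /transversalP[h _] := tJ; exact: h.
- exact: class_sort_sorted.
Qed.

Lemma enum_class_image (J : {set 'I_n}) : transversal nl t J ->
  [seq t i | i <- class_sort J] = enum [set t i | i in J].
Proof.
move=> tJ; apply: enum_set_eq => [|b].
  by rewrite -map_comp; exact: class_sort_sorted.
apply/mapP/imsetP => -[i iJ ->]; exists i => //; move: iJ;
  by rewrite mem_sort mem_enum.
Qed.

Section Deform.
Variable D : 'M[R]_(r, n).
Hypotheses (D_free : row_free D) (D_tnn : tnn_matrix D).
Hypothesis D_transversal : forall J : {set 'I_n}, #|J| = r ->
  max_minor D J != 0 -> transversal nl t J.

Lemma nonloop_column a i : D a i != 0 -> nl i.
Proof.
move=> /(basis_through D_free)[J [Jr iJ /(D_transversal Jr)/transversalP [h _]]].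
exact: h.
Qed.

(** Expand column [i] in a basis through [i'] by Cramer's rule. Replacing [i'] keeps the sequence of
    classes, so that the twisted minor is nonnegative; replacing any other element leaves both [i]
    and [i'], which is not a transversal. Only the multiple of column [i'] remains. *)
Lemma class_ratio i i' a' : nl i -> nl i' -> t i = t i' -> D a' i' != 0 ->
  exists2 p : R, 0 <= p & forall a, tail_twist D a i = p * tail_twist D a i'.
Proof.
move=> nli nli' tii' /(basis_through D_free)[J [Jr iJ Jnz]].
have tJ := D_transversal Jr Jnz.
set s := class_sort J; have sr : size s = r by rewrite size_sort -cardE.
have us : uniq s by rewrite sort_uniq enum_uniq.
have is' : i' \in s by rewrite mem_sort mem_enum.
have Js : max_minor D J = row_minor (tail_twist D)^T s by exact: class_sort_minor.
have Jpos : 0 < row_minor (tail_twist D)^T s.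
  by rewrite -Js lt_neqAle eq_sym Jnz D_tnn.
pose l0 := index i' s; have l0r : (l0 < r)%N by rewrite -sr index_mem.
pose s0 := set_nth i s l0 i.
have sz (l : nat) : (l < r)%N -> size (set_nth i s l i) = r.
  by move=> lr; rewrite size_set_nth sr; apply/maxn_idPr.
exists (row_minor (tail_twist D)^T s0 / row_minor (tail_twist D)^T s).
  rewrite divr_ge0 ?(ltW Jpos) // tail_twist_minor ?sz //.
  - have us0 : uniq s0.
      have : uniq [seq t j | j <- s0].
        have -> : [seq t j | j <- s0] = [seq t j | j <- s].
          apply: (@eq_from_nth _ ord0); rewrite !size_map sz // => j jr.
          rewrite (nth_map i) ?sz // (nth_map i) ?sr // nth_set_nth /=.
          by case: eqP => // ->; rewrite tii' nth_index.
        rewrite map_inj_in_uniq // => x y; rewrite !mem_sort !mem_enum.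
        by have /transversalP[_ h] := tJ; exact: h.
      by move/map_uniq.
    by apply: D_tnn; rewrite cardsE (card_uniqP us0) sz.
  - move=> x /(nthP i)[j]; rewrite sz // => jr <-; rewrite nth_set_nth /=.
    case: eqP => // _; have /transversalP[h _] := tJ; apply: h.
    by rewrite -mem_enum -(mem_sort (fun i j => (t i <= t j)%N)) mem_nth // sr.
  - have -> : [seq val (t j) | j <- s0] = [seq val (t j) | j <- s].
      apply: (@eq_from_nth _ 0%N); rewrite !size_map sz // => j jr.
      rewrite (nth_map i) ?sz // (nth_map i) ?sr // nth_set_nth /=.
      by case: eqP => // ->; rewrite tii' nth_index.
    exact: class_sort_sorted.
move=> a; have cr := row_minor_cramer (tail_twist D) i a sr.
apply: (mulfI (lt0r_neq0 Jpos)); rewrite cr (bigD1 (Ordinal l0r)) //= big1 ?addr0.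
  rewrite nth_index // mulrA [_ * (_ / _)]mulrC divfK //.
  exact: lt0r_neq0.
move=> l ll0; rewrite (_ : row_minor _ _ = 0) ?mul0r //.
have -> : (tail_twist D)^T = \matrix_(x, y) (tail_sign x * D^T x y).
  by apply/matrixP => x y; rewrite !mxE.
rewrite row_minor_scale ?sz //; apply/eqP; rewrite mulf_eq0 -[X in _ || X]normr_eq0.
rewrite row_minor_absE ?sz // mulf_eq0 pnatr_eq0 eqb0.
case: (boolP (uniq _)) => ul; last by rewrite orbT.
rewrite /= normr_eq0 [X in _ || X](_ : _ = true) ?orbT //.
set S := [set x in _]; have Sr : #|S| = r by rewrite cardsE (card_uniqP ul) sz.
apply/negPn/negP => /(D_transversal Sr)/transversalP [_ inj].
have e : nth i (set_nth i s l i) l = i by rewrite nth_set_nth /= eqxx.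
have e' : nth i (set_nth i s l i) l0 = i'.
  rewrite nth_set_nth /=; case: eqP => [h|_]; last by rewrite nth_index.
  by move: ll0; rewrite -val_eqE /= -h eqxx.
have iS : i \in S by rewrite inE -{1}e mem_nth // sz.
have i'S : i' \in S by rewrite inE -{1}e' mem_nth // sz.
have := inj _ _ iS i'S tii'; rewrite -{1}e -e' => /eqP.
rewrite nth_uniq ?sz // => /eqP h; case/eqP: ll0.
by apply: val_inj.
Qed.

(** A member of class [b] with nonzero column, if any. [U] collects these class vectors, with a zero
    column for every number that has no such representative. *)
Let rho b := [pick i | [&& nl i, t i == b & [exists a, D a i != 0]]].

Let U : 'M[R]_(r, n.+1) :=
  \matrix_(a, b) (if rho b is Some i then tail_twist D a i else 0).

Lemma class_factor : exists p : 'I_n -> R, (forall i, 0 <= p i) /\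
  forall a i, nl i -> tail_twist D a i = p i * U a (t i).
Proof.
suff h i : exists p, 0 <= p /\ forall a, nl i -> tail_twist D a i = p * U a (t i).
  have [p hp] := fin_all_exists h.
  by exists p; split=> [i|a i]; [exact: (hp i).1 | exact: (hp i).2].
have [nli|] := boolP (nl i); last by exists 0.
have [/existsP[a0 nz]|/existsPn no] := boolP [exists a, D a i != 0]; last first.
  exists 0; split=> // a _; rewrite mul0r mxE.
  by have := no a; rewrite negbK => /eqP ->; rewrite mulr0.
case E : (rho (t i)) => [i'|]; last first.
  move: E; rewrite /rho; case: pickP => // /(_ i); rewrite nli eqxx /=.
  by move/existsP; case; exists a0.
have [nli' /eqP tii' /existsP[a' nz']] : [/\ nl i', t i' == t i & [exists a, D a i' != 0]].
  by move: E; rewrite /rho; case: pickP => // x /and3P[? ? ?] [<-].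
have [p p0 pE] := class_ratio nli nli' (esym tii') nz'.
by exists p; split=> // a _; rewrite pE [U _ _]mxE E.
Qed.

(** If all classes in [B] have representatives, the minor of [U] is the minor of [D] on these, the
    twist compensating for the order by class; a class without representative contributes a zero
    column. *)
Lemma class_factor_tnn : tnn_matrix U.
Proof.
move=> B Br; have sB : size (enum B) = r by rewrite -cardE.
have [/existsP[b /andP[bB /eqP rb]]|/existsPn no] :=
    boolP [exists b, (b \in B) && (rho b == None)].
  rewrite /max_minor; pose d b' : R := (b' != b)%:R.
  rewrite (@row_minor_block _ _ _ U U id d) //; last first.
    by move=> a b' _; rewrite /d; have [->|_] := eqVneq b' b; rewrite ?mul1r // mul0r mxE rb.
  by rewrite big_enum (bigD1 b) //= /d eqxx !mul0r.
have [b0 b0B] : exists b0, b0 \in B by apply/set0Pn; rewrite -card_gt0 Br.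
have [x0] : exists i : 'I_n, true.
  by have := no b0; rewrite b0B /=; case: (rho b0) => // i _; exists i.
pose f b := odflt x0 (rho b).
have fP b : b \in B -> nl (f b) /\ t (f b) = b.
  move=> bB; have := no b; rewrite bB /= /f /rho; case: pickP => //= i.
  by move=> /and3P[? /eqP ? _] _.
have UE a b : b \in enum B -> U a b = 1 * tail_twist D a (f b).
  rewrite mem_enum mul1r mxE => bB; have := no b; rewrite bB /= /f.
  by case: (rho b).
move=> _; rewrite /max_minor (row_minor_block sB UE) big1_eq mul1r.
rewrite tail_twist_minor ?size_map //.
- apply: D_tnn; have uf : uniq [seq f b | b <- enum B].
    rewrite map_inj_in_uniq ?enum_uniq // => b b'.
    rewrite !mem_enum => bB b'B e; have [_ <-] := fP b bB; have [_ <-] := fP b' b'B.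
    by rewrite e.
  by rewrite cardsE (card_uniqP uf) size_map.
- by move=> i /mapP[b]; rewrite mem_enum => /fP[? _] ->.
- rewrite -map_comp (_ : map _ _ = [seq val b | b <- enum B]) ?enum_set_sorted //.
  by apply/eq_in_map => b; rewrite mem_enum => /fP[_ /= ->].
Qed.

Lemma class_factor_free : row_free U.
Proof.
have [J Jr nz] := (row_free_max_minor D).1 D_free.
have tJ := D_transversal Jr nz; have [p [p0 pE]] := class_factor.
apply/row_free_max_minor; exists [set t i | i in J].
  by rewrite card_in_imset //; have /transversalP[_] := tJ.
move: nz; rewrite class_sort_minor // (@row_minor_block _ _ _ _ U t p).
- by rewrite mulf_eq0 negb_or enum_class_image // => /andP[].
- by rewrite size_sort -cardE.
- move=> a i; rewrite mem_sort mem_enum => iJ; apply: pE.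
  by have /transversalP[h _] := tJ; exact: h.
Qed.

Import numFieldNormedType.Exports.
Local Open Scope classical_set_scope.

(* Smoothing the class vectors by a Gaussian kernel and making all the ratios
   within a class nonzero turns [D] into a generic point of the block structure. *)
Lemma exists_deformation : exists Dq : R -> 'M[R]_(r, n),
  (forall a i, Dq q a i @[q --> (0 : R)] --> D a i) /\
  forall q (J : {set 'I_n}), 0 < q -> q * (r`!)%:R < 1 -> #|J| = r ->
    if transversal nl t J then 0 < max_minor (Dq q) J else max_minor (Dq q) J == 0.
Proof.
have [p [p0 pE]] := class_factor.
(* The ratio [p i] is 0 when column [i] of [D] vanishes; adding [q] makes it positive. The factor
   [tail_sign i] undoes the twist. *)
pose d q i : R := if nl i then tail_sign i * (p i + q) else 0.
pose Dq q : 'M[R]_(r, n) := \matrix_(a, i) (d q i * (U *m gauss n.+1 q) a (t i)).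
exists Dq; split=> [a i|q J q0 qr Jr].
  (* At q = 0 the kernel is the identity matrix, because the power with exponent [sqdist] is 1 on
     the diagonal and 0 elsewhere. *)
  have limE : D a i = (if nl i then tail_sign i * (p i + 0) else 0) *
      \sum_b U a b * 0 ^+ sqdist b (t i).
    rewrite (bigD1 (t i)) //= big1 ?addr0.
      rewrite (_ : sqdist _ _ = 0%N) ?expr0 ?mulr1; last by rewrite /sqdist subnn.
      have [nli|nli] := boolP (nl i).
        by rewrite -mulrA -pE // mxE mulrA tail_signK mul1r.
      by rewrite mul0r; apply/eqP; apply: contraNT nli; exact: nonloop_column.
    move=> b bt; rewrite expr0n /sqdist expn_eq0 /= andbT addn_eq0 !subn_eq0 -eqn_leq.
    by rewrite val_eqE (negPf bt) mulr0.
  rewrite limE; under eq_fun do rewrite !mxE.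
  apply: cvgM.
    rewrite /d; case: (nl i); last exact: cvg_cst.
    by apply: cvgM; [exact: cvg_cst|apply: cvgD; [exact: cvg_cst|exact: cvg_id]].
  apply: cvg_bigsum => b; apply: cvgM; first exact: cvg_cst.
  by under eq_fun do rewrite mxE; apply: cvg_exprn; exact: cvg_id.
have sr : size (enum J) = r by rewrite -cardE.
case: ifP => tJ.
  rewrite class_sort_minor // (@row_minor_block _ _ _ _ (U *m gauss n.+1 q) t (fun i => p i + q)).
  - rewrite mulr_gt0 //.
      by rewrite big_seq; apply: prodr_gt0 => i _; rewrite ltr_wpDl.
    rewrite enum_class_image //.
    apply: gauss_smoothing => //; [exact: class_factor_tnn|exact: class_factor_free|].
    by rewrite card_in_imset //; have /transversalP[_] := tJ.
  - by rewrite size_sort -cardE.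
  - move=> a i; rewrite mem_sort mem_enum => iJ; rewrite mxE mxE /d.
    have /transversalP[/(_ i iJ) -> _] := tJ.
    by rewrite !mulrA tail_signK mul1r.
apply/eqP; rewrite /max_minor (@row_minor_block _ _ _ _ (U *m gauss n.+1 q) t (d q)) //; last first.
  by move=> a i _; rewrite mxE.
have [/allP allnl|/allPn[i iJ nli]] := boolP (all nl (enum J)); last first.
  rewrite big_enum (bigD1 i) /= ?mul0r //; last by rewrite mem_enum in iJ.
  by rewrite /d (negPf nli) !mul0r.
rewrite row_minor_notuniq ?mulr0 ?size_map //.
apply: contraFN tJ => um; apply/transversalP; split=> [i iJ|i j iJ jJ e].
  by apply: allnl; rewrite mem_enum.
have ii : i \in enum J by rewrite mem_enum.
have jj : j \in enum J by rewrite mem_enum.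
have := uniqP ord0 um (index i (enum J)) (index j (enum J)).
rewrite !inE !size_map !index_mem => /(_ ii jj).
rewrite !(nth_map i) ?index_mem // !nth_index // => /(_ e) ei.
by rewrite -[i](nth_index i ii) ei nth_index.
Qed.

End Deform.
End RowMinorBlocks.

(** * Closures of faces *)

Section Density.
Import numFieldNormedType.Exports.
Local Open Scope classical_set_scope.
Variables (R : realType) (n k : nat) (Z : 'M[R]_(n, k.+2)).
Hypothesis Zpos : forall J : {set 'I_n}, #|J| = k.+2 -> 0 < row_minor Z (enum J).
Hypotheses (k0 : (0 < k)%N) (kn : (k + 2 <= n)%N).

Definition ordered_coord (p : {set 'I_n} -> R) (x y : 'I_n) : R :=
  if (x < y)%N then p [set x; y]%SET else if (y < x)%N then - p [set x; y]%SET else 0.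

Lemma bracket_ordered_coord (u : 'M[R]_(2, n)) p c :
  (forall I : {set 'I_n}, #|I| = 2 -> max_minor u I = c * p I) ->
  forall x y, bracket u x y = c * ordered_coord p x y.
Proof.
move=> h x y; rewrite /ordered_coord; case: ltngtP => [xy|yx|/val_inj ->].
- by rewrite -h ?max_minor_bracket // cards2 -val_eqE (ltn_eqF xy).
- rewrite mulrN -h; last by rewrite cards2 eq_sym -val_eqE (ltn_eqF yx).
  by rewrite finset.setUC max_minor_bracket // bracketC.
- by rewrite mulr0 /bracket subrr.
Qed.

Lemma bracket_cramer (u : 'M[R]_(2, n)) a b x i :
  bracket u a b * u i x = bracket u x b * u i a + bracket u a x * u i b.
Proof.
have : i = 0 \/ i = 1.
  by case: i => [[|[|?]]] // ?; [left|right]; apply: val_inj.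
by rewrite /bracket => -[] ->; ring.
Qed.

(* The frame of the same plane as [v] whose columns [a] and [b] agree with those of [u]. *)
Lemma reframe (u v : 'M[R]_(2, n)) a b W : frame v W ->
  bracket u a b != 0 -> bracket v a b != 0 ->
  frame (\matrix_(i, x) ((bracket v x b * u i a + bracket v a x * u i b) / bracket v a b)) W.
Proof.
move=> fv nu nv.
(* The block of [u] on the columns [a], [b], times the inverse of the same block of [v]. *)
pose g : 'M[R]_2 := \matrix_(i, j) ((if j == 0 then u i a * v 1 b - u i b * v 1 a
  else u i b * v 0 a - u i a * v 0 b) / bracket v a b).
have -> : \matrix_(i, x) ((bracket v x b * u i a + bracket v a x * u i b) / bracket v a b)
    = g *m v.
  apply/matrixP => i x; rewrite !mxE !big_ord_recl big_ord0 addr0 !mxE /=.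
  rewrite (_ : lift ord0 ord0 = 1); last exact: val_inj.
  by rewrite [X in _ = X + _]mulrAC [X in _ = _ + X]mulrAC -mulrDl; congr (_ / _); rewrite /bracket; ring.
apply: frame_mull => //; rewrite unitmxE unitfE det2 !mxE /=.
have -> : forall p q r s d : R, p / d * (q / d) - r / d * (s / d) = (p * q - r * s) / d / d.
  by move=> p q r s d; rewrite !mulrBl !mulrA; congr (_ - _); rewrite -!mulrA; congr (_ * _);
    rewrite mulrCA.
have -> : (u 0 a * v 1 b - u 0 b * v 1 a) * (u 1 b * v 0 a - u 1 a * v 0 b) -
    (u 0 b * v 0 a - u 0 a * v 0 b) * (u 1 a * v 1 b - u 1 b * v 1 a) =
    bracket u a b * bracket v a b by rewrite /bracket; ring.
by rewrite !mulf_neq0 ?invr_neq0.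
Qed.

(** Remove from [J0] the at most two elements in the classes of [i] and [b], trim to [r - 2]
    elements, and add [i] and [b]. Thus every pair of [N] survives in [down2] of the deformed
    point. *)
Lemma transversal_through nl (t : 'I_n -> 'I_n.+1) (J0 : {set 'I_n}) i b r :
  (2 <= r)%N -> #|J0| = r -> transversal nl t J0 -> nl i -> nl b -> t i != t b ->
  exists J : {set 'I_n}, [/\ #|J| = r, transversal nl t J, i \in J & b \in J].
Proof.
move=> r2 J0r /transversalP [h1 h2] nli nlb tib.
have nib : i != b by apply: contraNneq tib => ->.
pose J1 := [set x in J0 | (t x != t i) && (t x != t b)]%SET.
have J1r : (r - 2 <= #|J1|)%N.
  have c : (#|J0 :\: J1| <= 2)%N.
    rewrite -(card_in_imset (f := t)); last first.
      by move=> x y; rewrite !inE => /andP[_ xJ] /andP[_ yJ]; exact: h2.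
    apply: leq_trans (_ : #|[set t i; t b]%SET| <= 2)%N; last by rewrite cards2; case: eqP.
    apply/subset_leq_card/fintype.subsetP => _ /imsetP[x + ->]; rewrite !inE.
    by move=> /andP[+ xJ]; rewrite xJ /= negb_and !negbK.
  have := cardsID J1 J0; rewrite J0r => e; have := subset_leq_card (subsetIr J0 J1); lia.
have [J2 [J2s J2r]] : exists J2 : {set 'I_n}, J2 \subset J1 /\ #|J2| = (r - 2)%N.
  exists [set x in take (r - 2) (enum J1)]%SET; split.
    by apply/fintype.subsetP => x; rewrite inE => /mem_take; rewrite mem_enum.
  rewrite cardsE (card_uniqP _) ?take_uniq ?enum_uniq // size_take -cardE.
  by case: ltnP => //; lia.
have iJ2 : i \notin J2 by apply/negP => /(fintype.subsetP J2s); rewrite !inE eqxx !andbF.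
have bJ2 : b \notin J2 by apply/negP => /(fintype.subsetP J2s); rewrite !inE eqxx !andbF.
have J2P x : x \in J2 -> [/\ x \in J0, t x != t i & t x != t b].
  by move=> /(fintype.subsetP J2s); rewrite inE => /and3P.
exists (i |: (b |: J2))%SET; split; rewrite ?inE ?eqxx ?orbT //.
  by rewrite !cardsU1 !inE negb_or nib iJ2 bJ2 J2r /=; lia.
apply/transversalP; split=> [x|x y].
  by rewrite !inE => /or3P[/eqP ->|/eqP ->|/J2P[/h1]].
have absurd (p q : 'I_n.+1) : p = q -> p != q -> x = y by move=> ->; rewrite eqxx.
rewrite !inE => /or3P[/eqP ex|/eqP ex|/J2P[xJ xi xb]]
  /or3P[/eqP ey|/eqP ey|/J2P[yJ yi yb]]; rewrite ?ex ?ey // => e.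
- by rewrite ex ey in absurd; exact: absurd e tib.
- by rewrite ex in absurd; exact: absurd (esym e) yi.
- by rewrite ex ey in absurd; exact: absurd (esym e) tib.
- by rewrite ex in absurd; exact: absurd (esym e) yb.
- by rewrite ey in absurd; exact: absurd e xi.
- by rewrite ey in absurd; exact: absurd e xb.
- exact: h2.
Qed.

(** Every pair inside [J] belongs to [down2]. Having a second element in [J] is what shows that each
    element is a nonloop. *)
Lemma down2_transversal (A : 'M[R]_(k, n)) (nl : pred 'I_n) (t : 'I_n -> 'I_n.+1)
    (J : {set 'I_n}) :
  down2 (matroid_mx A) \subset block_matroid nl t -> (2 <= #|J|)%N ->
  finset.setC J \in matroid_mx A -> transversal nl t J.
Proof.
move=> sub J2 JA.
have pair i j : i \in J -> j \in J -> i != j -> [&& nl i, nl j & t i != t j].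
  move=> iJ jJ nij; rewrite -mem_block_matroid; apply: (fintype.subsetP sub).
  apply/mem_down2; rewrite cards2 nij; split=> //; exists (finset.setC J) => //.
  rewrite disjoint_sym finset.disjoints_subset finset.setCK.
  by apply/fintype.subsetP => x; rewrite !inE => /orP[] /eqP ->.
apply/transversalP; split=> [i iJ|i j iJ jJ e].
  have [j jJ nij] : exists2 j, j \in J & j != i.
    have : (0 < #|J :\ i|)%N by move: J2; rewrite (cardsD1 i J) iJ.
    by rewrite card_gt0 => /set0Pn[j]; rewrite !inE => /andP[? ?]; exists j.
  by rewrite eq_sym in nij; have /and3P[] := pair _ _ iJ jJ nij.
apply/eqP/negPn/negP => nij; have /and3P[_ _] := pair _ _ iJ jJ nij.
by rewrite e eqxx.
Qed.

Lemma closure_face N (A : 'M[R]_(k, n)) (u : 'M[R]_(2, n)) W :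
  positroids R 2 N -> row_free A -> tnn_matrix A -> twistor_mx Z A u -> frame u W ->
  down2 (matroid_mx A) \subset N -> closure (amplituhedron_face Z N) W.
Proof.
move=> pN Af At Au fu dN; apply: (frame_closure fu) => O oO Ou.
have [nl [tl [t [Dat eN]]]] := positroid_blocks pN.
pose r := (n - k)%N.
have nkr : n = (k + r)%N by rewrite subnKC //; lia.
have nrk : n = (r + k)%N by rewrite addnC.
have r2 : (2 <= r)%N by rewrite /r; lia.
have r0 : (0 < r)%N by exact: ltnW.
have cC (J : {set 'I_n}) : #|J| = r -> #|finset.setC J| = k.
  by move=> Jr; rewrite cardsCs finset.setCK card_ord Jr; lia.
have cC' (J : {set 'I_n}) : #|J| = k -> #|finset.setC J| = r.
  by move=> Jr; rewrite cardsCs finset.setCK card_ord Jr.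
have [D DE] := exists_dual nkr r0 Af.
have Df : row_free D.
  have [K Kk nz] := (row_free_max_minor A).1 Af.
  apply/row_free_max_minor; exists (finset.setC K); first exact: cC'.
  by rewrite DE ?cC' // finset.setCK.
have Dt : tnn_matrix D by move=> J Jr; rewrite DE //; apply: At; exact: cC.
have DT (J : {set 'I_n}) : #|J| = r -> max_minor D J != 0 -> transversal nl t J.
  move=> Jr nz; apply: (@down2_transversal A); rewrite -?eN // ?Jr //.
  by rewrite inE cC // eqxx -DE.
have [Dq [Dlim Dpos]] := exists_deformation Dat r0 Df Dt DT.
(* Written in the complementary minors of [Dq q], so that the limit can be taken before a dual
   matrix is chosen; for suitable [q] these are exactly the twistor sums of [Aq], with no scalar in
   between. *)
pose tw q := twistor_sum Z (fun K => max_minor (Dq q) (finset.setC K)).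
pose tw0 := twistor_sum Z (max_minor A).
have twlim I : tw q I @[q --> 0^'+] --> tw0 I.
  apply: cvg_bigsum_cond => K /eqP Kk; apply: cvgM; last exact: cvg_cst.
  rewrite -[K in max_minor A K]finset.setCK -DE ?cC' //.
  apply: cvg_row_minor => i j; rewrite mxE; under eq_fun do rewrite mxE.
  by apply: cvg_at_right_filter; exact: Dlim.
have brlim x y : ordered_coord (tw q) x y @[q --> 0^'+] --> ordered_coord tw0 x y.
  rewrite /ordered_coord; case: ltngtP => _; [exact: twlim| |exact: cvg_cst].
  by apply: cvgN; exact: twlim.
have [c c0 cu] := Au.
have brE := bracket_ordered_coord cu; rewrite -/tw0 in brE.
have [I0 I02 I0nz] := (row_free_max_minor u).1 (frame_row_free fu).
have [a [b nab]] : exists a b, bracket u a b != 0.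
  move: I02 I0nz => /eqP/cards2P[a [b [nab ->]]]; rewrite max_minor_bracket_neq0 // => h.
  by exists a, b.
have br0 : ordered_coord tw0 a b != 0.
  by move: nab; rewrite brE mulf_eq0 negb_or => /andP[].
(* This will be a frame of the image of [Aq]. Sharing the columns [a] and [b] with [u], it tends to
   [u] itself and not just to some frame of [W]; having degree 0 in the coordinates, it is
   insensitive to the scalar of the twistor map. *)
pose M q : 'M[R]_(2, n) := \matrix_(i, x)
  ((ordered_coord (tw q) x b * u i a + ordered_coord (tw q) a x * u i b) /
   ordered_coord (tw q) a b).
have Mlim : M q @[q --> 0^'+] --> u.
  apply: cvg_mx => i x; under eq_fun do rewrite mxE.
  have -> : u i x = (ordered_coord tw0 x b * u i a + ordered_coord tw0 a x * u i b) /
      ordered_coord tw0 a b.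
    apply: (mulfI nab); rewrite bracket_cramer !brE.
    by field.
  apply: cvgM; last exact: cvgV.
  by apply: cvgD; apply: cvgM; rewrite ?brlim //; exact: cvg_cst.
have near1 : \forall q \near 0^'+, O (M q).
  by apply: Mlim; exact: open_nbhs_nbhs.
have near2 : \forall q \near 0^'+, ordered_coord (tw q) a b != 0.
  apply: (brlim a b [set y | y != 0]); apply: open_nbhs_nbhs.
  by split; [exact: open_neq | exact: br0].
have near3 : \forall q \near (0 : R)^'+, q < (r`!)%:R^-1.
  by apply: nbhs_right_lt; rewrite invr_gt0 ltr0n fact_gt0.
have near4 : \forall q \near 0^'+, O (M q) /\ (ordered_coord (tw q) a b != 0 /\
    (0 < q /\ q < (r`!)%:R^-1)).
  apply: filterI near1 _; apply: filterI near2 _.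
  by apply: filterI _ near3; exact: nbhs_right_gt.
have [q [OM [brq [q0 qr']]]] := @filter_ex _ _ (at_right_proper_filter (0 : R)) _ near4.
have qr : q * (r`!)%:R < 1 by rewrite -ltr_pdivlMr ?ltr0n ?fact_gt0 // div1r.
have Dq_pos J Jr := Dpos q J q0 qr Jr.
have [J0 J0r J0nz] := (row_free_max_minor D).1 Df.
have J0t := DT _ J0r J0nz.
have Dqf : row_free (Dq q).
  apply/row_free_max_minor; exists J0 => //.
  by have := Dq_pos _ J0r; rewrite J0t => /lt0r_neq0.
have [Aq AqE] := exists_dual nrk k0 Dqf.
have Aqt : tnn_matrix Aq.
  move=> K Kk; rewrite AqE //; have := Dq_pos _ (cC' _ Kk).
  by case: ifP => _; [exact: ltW | move/eqP ->].
have Aqf : row_free Aq.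
  apply/row_free_max_minor; exists (finset.setC J0); first exact: cC.
  rewrite AqE ?cC // finset.setCK.
  by have := Dq_pos _ J0r; rewrite J0t => /lt0r_neq0.
have Aq_down : down2 (matroid_mx Aq) = N.
  apply/eqP; rewrite finset.eqEsubset eN; apply/andP; split; apply/fintype.subsetP => I.
    move=> /mem_down2[I2 [K]]; rewrite !inE => /andP[/eqP Kk nz] d; rewrite I2 eqxx /=.
    have := Dq_pos _ (cC' _ Kk); rewrite -AqE //; case: ifP => [tK _|_]; last by rewrite (negPf nz).
    have IK : I \subset finset.setC K by rewrite -finset.disjoints_subset disjoint_sym.
    have /transversalP [h1 h2] := tK; apply/transversalP; split=> [x|x y] /(fintype.subsetP IK).
      exact: h1.
    by move=> xK /(fintype.subsetP IK) yK; exact: h2.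
  move=> IN; have I2 : #|I| = 2 by move: IN; rewrite inE => /andP[/eqP].
  have /eqP/cards2P[i [j [nij eI]]] := I2; rewrite eI in IN I2 *.
  move: IN; rewrite mem_block_matroid => /and3P[nli nlj tij].
  have [J [Jr Jt iJ jJ]] := transversal_through r2 J0r J0t nli nlj tij.
  apply/mem_down2; split=> //; exists (finset.setC J).
    rewrite inE cC // eqxx AqE ?cC // finset.setCK.
    by have := Dq_pos _ Jr; rewrite Jt => /lt0r_neq0.
  rewrite disjoint_sym finset.disjoints_subset finset.setCK.
  by apply/fintype.subsetP => x; rewrite !inE => /orP[] /eqP ->.
have twE I : twistor_sum Z (max_minor Aq) I = tw q I.
  by apply: eq_bigr => K /eqP Kk; rewrite AqE.
have [I1 I12 I1nz] := tnn_twistor_neq0 Zpos k0 kn Aqf Aqt.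
have [v vf Av] := exists_twistor I12 I1nz.
have [Wq fv] := row_free_frame vf.
have [c' c'0 cv] := Av.
have brvE := bracket_ordered_coord cv.
have oE x y : ordered_coord (twistor_sum Z (max_minor Aq)) x y = ordered_coord (tw q) x y.
  by rewrite /ordered_coord !twE.
have nv : bracket v a b != 0 by rewrite brvE oE mulf_neq0.
exists (M q), Wq; split => //.
  split; first by apply/(amplituhedronP Z k0 fv); exists Aq.
  exact: open_positroid_of_down2 Aqt Av fv pN Aq_down.
have := reframe fv nab nv; congr (frame _ Wq); apply/matrixP => i x; rewrite !mxE !brvE !oE.
by field; rewrite brq c'0.
Qed.

End Density.

(** * Nonempty faces and their closure relations *)

Local Open Scope classical_set_scope.

Theorem theorem4p6 (R : realType) (n k : nat) (Z : 'M[R]_(n, k.+2)) :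
  (1 <= k)%N -> (k + 2 <= n)%N ->
  (forall J : {set 'I_n}, #|J| = k.+2 -> 0 < row_minor Z (enum J)) ->
  (forall N : {set {set 'I_n}}, positroids R 2 N ->
     (amplituhedron_face Z N !=set0 <-> env_down2_positroids R k N)) /\
  (forall N : {set {set 'I_n}}, env_down2_positroids R k N ->
     closure (amplituhedron_face Z N) =
     \bigcup_(N' in [set N' : {set {set 'I_n}} |
                      env_down2_positroids R k N' /\ N' \subset N])
       amplituhedron_face Z N').
Proof.
move=> k0 kn Zpos.
have face_env N W : positroids R 2 N -> amplituhedron_face Z N W ->
    exists A u, [/\ row_free A, tnn_matrix A, twistor_mx Z A u, frame u W &
      is_envelope R 2 (down2 (matroid_mx A)) N].
  move=> pN [/(amplituhedronP Z k0 (frame_vbasis W)) [A [Af At Au]] WN].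
  exists A, (\matrix_(i < 2) (vbasis (val W))`_i); split => //; first exact: frame_vbasis.
  exact: (face_envelope Zpos At Au (frame_vbasis W) pN WN).
have env_of_tnn (A : 'M[R]_(k, n)) N : row_free A -> tnn_matrix A ->
    is_envelope R 2 (down2 (matroid_mx A)) N -> env_down2_positroids R k N.
  move=> Af At AN; exists (matroid_mx A) => //.
  by apply/(positroid_mxP R (matroid_mx A) k0); exists A.
split=> [N pN|N [M pM envN]].
  split=> [[W /(face_env _ _ pN) [A [u [Af At _ _ AN]]]]|[M pM envN]].
    exact: env_of_tnn AN.
  have [A [Af At] eM] := (positroid_mxP R M k0).1 pM.
  have [I I2 nz] := tnn_twistor_neq0 Zpos k0 kn Af At.
  have [u uf Au] := exists_twistor I2 nz; have [W fu] := row_free_frame uf.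
  (* The image lies in some stratum, whose positroid is again the envelope of [down2 M], so
     uniqueness identifies it with [N]. *)
  have [N' pN' WN'] := exists_stratum W.
  have envN' := face_envelope Zpos At Au fu pN' WN'.
  rewrite eM in envN; rewrite (envelope_unique envN envN').
  by exists W; split=> //; apply/(amplituhedronP Z k0 fu); exists A.
have pN : positroids R 2 N by case: envN.
apply/seteqP; split=> W.
  move=> clW; have ampW : amplituhedron Z W.
    by apply: (closure_amplituhedron Zpos k0 kn _ clW) => W' [].
  have [N' pN' WN'] := exists_stratum W.
  have [A [u [Af At Au fu AN']]] := face_env _ _ pN' (conj ampW WN').
  exists N'; last by split.
  split; first exact: env_of_tnn AN'.
  (* The first bases of [N'] are nonzero at [W], while coordinates outside [N] vanish on the face
     and therefore at its limit [W]. So [N] contains the first bases of [N']. *)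
  have [_ first] := (open_positroidP pN' fu).1 WN'.
  apply: (sub_of_first_partners pN) => [I|i b /first]; first exact: positroid_card pN'.
  apply: (fintype.subsetP (closed_matroid_sub _ fu clW)).
  move=> W' u' fu' [_ W'N]; exact: ((open_positroidP pN fu').1 W'N).1.
move=> [N' [[M' _ [pN' _ _]] N'N] /(face_env _ _ pN') [A [u [Af At Au fu [_ sub _]]]]].
apply: (closure_face Zpos k0 kn pN Af At Au fu).
exact: fintype.subset_trans sub N'N.
Qed.
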